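(* Let $X,Y$ be uniform spaces and $G$ an internal abelian group. If two uniformly continuous maps $f,g:X\to Y$ are uniformly homotopic, then the induced chain maps $M_\bullet(f;G),M_\bullet(g;G):M_\bullet(X;G)\to M_\bullet(Y;G)$ are chain homotopic; hence $H_\bullet(f;G)=H_\bullet(g;G)$. The same holds in the relative case: if $A\subseteq X$, $B\subseteq Y$ and $f,g:(X,A)\to(Y,B)$ are uniformly continuous maps of pairs that are uniformly homotopic as maps of pairs, then the induced chain maps $M_\bullet(X,A;G)\to M_\bullet(Y,B;G)$ are chain homotopic, and hence the induced maps $H_\bullet(X,A;G)\to H_\bullet(Y,B;G)$ are equal.
   Context: Nonstandard setting: fix a standard universe $\mathbb{U}$ satisfying sufficiently many axioms of ZFC and containing all standard objects considered (uniform spaces are standard), and an elementary extension ${}^{\ast}\mathbb{U}$ of $\mathbb{U}$ (the internal universe) that is $|\mathbb{U}|^{+}$-saturated; $x\mapsto{}^{\ast}x$ is the elementary embedding. ''Internal'' means belonging to ${}^{\ast}\mathbb{U}$; ''hyperfinite'' means finite in the sense of ${}^{\ast}\mathbb{U}$. For a uniform space $X$, points $x,y\in{}^{\ast}X$ are infinitely close, $x\approx y$, if $(x,y)\in{}^{\ast}U$ for every entourage $U$ of $X$. Subsets of uniform spaces carry the subspace uniformity, and products the product uniformity. $\mu$-homology: $C_p(X;G)$ is the internal abelian group of hyperfinite formal sums $\sum_{i=0}^{n}g_i\sigma_i$ with $\{g_i\}_{i=0}^n$ and $\{\sigma_i\}_{i=0}^n$ internal hyperfinite sequences in $G$ and in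 ${}^{\ast}X^{p+1}$ respectively (equivalently, internal functions ${}^{\ast}X^{p+1}\to G$ with hyperfinite support). A $p$-microsimplex is $(a_0,\ldots,a_p)\in{}^{\ast}X^{p+1}$ with $a_i\approx a_j$ for all $i,j\le p$. $M_p(X;G)\subseteq C_p(X;G)$ is the subgroup of $p$-microchains, i.e. elements representable as $\sum_{i=0}^n g_i\sigma_i$ with $\{g_i\}$, $\{\sigma_i\}$ internal hyperfinite sequences and every $\sigma_i$ a $p$-microsimplex; $M_p=0$ for $p<0$. The boundary $\partial_p:M_p(X;G)\to M_{p-1}(X;G)$ is the restriction of the internal homomorphism determined by $\partial_p(a_0,\ldots,a_p)=\sum_{i=0}^p(-1)^i(a_0,\ldots,\hat a_i,\ldots,a_p)$ ($\partial_0=0$). $H_\bullet(X;G)$ is the homology of the chain complex $M_\bullet(X;G)$. A uniformly continuous map $f:X\to Y$ induces a chain map $M_\bullet(f;G)$, determined by $(a_0,\ldots,a_p)\mapsto({}^{\ast}f(a_0),\ldots,{}^{\ast}f(a_p))$ and extended to hyperfinite sums, and $H_\bullet(f;G)$ is the induced map on homology. For $A\subseteq X$, $M_\bullet(A;G)$ is identified with a subcomplex of $M_\bullet(X;G)$ via the inclusion, $M_\bullet(X,A;G)=M_\bullet(X;G)/M_\bullet(A;G)$, and $H_\bullet(X,A;G)$ is its homology; uniformly continuous maps of pairs $f:(X,A)\to(Y,B)$ (i.e. $f(A)\subseteq B$) induce maps on these. Uniformly continuous maps $f,g:X\to Y$ are uniformly homotopic if there is a uniformly continuous map $h:X\times[0,1]\to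 Y$ (with $[0,1]$ carrying its usual uniformity) such that $h(\cdot,0)=f$ and $h(\cdot,1)=g$. Maps of pairs $f,g:(X,A)\to(Y,B)$ are uniformly homotopic as maps of pairs if such an $h$ exists with $h(A\times[0,1])\subseteq B$. *)

(* Defs.v *)
From HB Require Import structures.
From mathcomp Require Import all_boot all_order all_algebra.
From mathcomp Require Import all_classical all_reals all_analysis.

Set Implicit Arguments.
Unset Strict Implicit.
Unset Printing Implicit Defensive.
Import Order.TTheory GRing.Theory Num.Theory.
Import numFieldNormedType.Exports.
Local Open Scope classical_set_scope.
Local Open Scope ring_scope.

Record mstruct := MStruct { dom :> Type; smem : dom -> dom -> Prop }.

Notation "x ∈ y" := (smem x y) (at level 70, no associativity).

Section SetTheory.
Variable M : mstruct.
Implicit Types x y z s n f : M.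

Definition is_empty x := forall z, ~ z ∈ x.
Definition is_upair w x y := forall z, z ∈ w <-> z = x \/ z = y.
(* Kuratowski: w = {{x}, {x, y}}. *)
Definition is_pair w x y :=
  forall z, z ∈ w <-> is_upair z x x \/ is_upair z x y.
Definition pair_in f x y := exists w, w ∈ f /\ is_pair w x y.
Definition is_succ x s := forall z, z ∈ s <-> z ∈ x \/ z = x.
Definition is_inductive w :=
  (forall e, is_empty e -> e ∈ w) /\
  (forall x s, x ∈ w -> is_succ x s -> s ∈ w).
Definition is_nat n := forall w, is_inductive w -> n ∈ w.

(* Separation ranges over all predicates of the metatheory, i.e., a set of
   the structure has all its subsets in the structure, as in V_lambda or a
   Grothendieck universe.  Choice for the structure then follows from choice
   in the metatheory; replacement and foundation are not required. *)
Record zermelo : Prop := Zermelo {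
  extensionality : forall x y, (forall z, z ∈ x <-> z ∈ y) -> x = y;
  pairing : forall x y, exists w, is_upair w x y;
  union : forall x, exists u, forall z, z ∈ u <-> exists2 y, z ∈ y & y ∈ x;
  power_set : forall x, exists u,
    forall y, y ∈ u <-> forall z, z ∈ y -> z ∈ x;
  infinity : exists w, (exists2 e, is_empty e & e ∈ w) /\
    forall x, x ∈ w -> exists2 s, is_succ x s & s ∈ w;
  separation : forall (P : M -> Prop) x, exists y,
    forall z, z ∈ y <-> z ∈ x /\ P z }.

End SetTheory.

Inductive form :=
  | FMem of nat & nat
  | FEq of nat & nat
  | FNot of form
  | FAnd of form & form
  | FAll of form.

Definition scons (T : Type) (x : T) (e : nat -> T) (n : nat) : T :=
  if n is m.+1 then e m else x.

(* de Bruijn indices: FAll binds the variable 0 *)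
Fixpoint sat (M : mstruct) (e : nat -> M) (phi : form) : Prop :=
  match phi with
  | FMem i j => e i ∈ e j
  | FEq i j => e i = e j
  | FNot p => ~ sat e p
  | FAnd p q => sat e p /\ sat e q
  | FAll p => forall x, sat (scons x e) p
  end.

Definition elementary (U V : mstruct) (star : U -> V) :=
  forall (phi : form) (e : nat -> U), sat e phi <-> sat (star \o e) phi.

(* A family, of cardinality at most that of K, of formulas phi i in the free
   variable 0 with parameters e i from V. *)
Definition saturated (K : Type) (V : mstruct) :=
  forall (I : Type) (c : I -> K) (phi : I -> form) (e : I -> nat -> V),
    injective c ->
    (forall (k : nat) (j : 'I_k -> I), exists x,
        forall l, sat (scons x (e (j l))) (phi (j l))) ->
    exists x, forall i, sat (scons x (e i)) (phi i).

Record nonstandard_universe := NonstandardUniverse {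
  std_univ : mstruct;
  int_univ : mstruct;
  star : std_univ -> int_univ;
  std_zermelo : zermelo std_univ;
  star_elementary : elementary star;
  int_saturated : saturated std_univ int_univ }.

(* A bijection of T with the elements of a set of U. *)
Record coding (U : mstruct) (T : Type) := Coding {
  code :> T -> U;
  cset : U;
  code_inj : injective code;
  csetP : forall u, u ∈ cset <-> exists t, code t = u }.

Section SubCoding.
Variables (U : mstruct) (zU : zermelo U) (T : Type) (c : coding U T).
Variable A : set T.

Let sub_cset := cid (separation zU (fun u => exists2 t, A t & c t = u) (cset c)).

Fact sub_code_inj : injective (fun t : A => c (set_val t)).
Proof. by move=> s t h; apply: val_inj; exact: (code_inj h). Qed.

Fact sub_csetP u :
  u ∈ projT1 sub_cset <-> exists t : A, c (set_val t) = u.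
Proof.
rewrite (projT2 sub_cset u); split=> [[_ [t At <-]]|[t <-]].
  by exists (exist _ t (mem_set At)).
by split; [apply/csetP; exists (set_val t) | exists (set_val t) => //; exact: set_valP].
Qed.

Definition sub_coding : coding U A := Coding sub_code_inj sub_csetP.

End SubCoding.

Section Star.
Variable N : nonstandard_universe.
Local Notation U := (std_univ N).
Local Notation V := (int_univ N).

Definition codes_rel (S T : Type) (cS : coding U S) (cT : coding U T)
    (E : S -> T -> Prop) (e : U) :=
  forall z, z ∈ e <-> exists x y, E x y /\ is_pair z (cS x) (cT y).

Definition star_rel (S T : Type) (cS : coding U S) (cT : coding U T)
    (E : S -> T -> Prop) (x y : V) :=
  exists2 e : U, codes_rel cS cT E e & pair_in (star e) x y.

(* The value outside *S is irrelevant. *)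
Definition star_fun (S T : Type) (cS : coding U S) (cT : coding U T)
    (f : S -> T) (x : V) : V :=
  @xget {classic V} x [set y | star_rel cS cT (fun s t => f s = t) x y].

Definition infinitely_close (X : uniformType) (cX : coding U X) (x y : V) :=
  forall E : set (X * X), entourage E ->
    star_rel cX cX (fun a b => E (a, b)) x y.

End Star.

Record internal_group (V : mstruct) := InternalGroup {
  igroup :> zmodType;
  icoding : coding V igroup;
  iadd : exists s : V, forall x y z : igroup,
    (exists w, is_pair w (icoding x) (icoding y) /\ pair_in s w (icoding z))
    <-> x + y = z }.

(* The restriction of s to the elements of n is an internal function. *)
Definition internal_seq (V : mstruct) (n : V) (s : V -> V) :=
  exists f : V, forall i y, pair_in f i y <-> i ∈ n /\ y = s i.

Section Chains.
Variables (V : mstruct) (G : internal_group V).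

(* The sum of the g i for i < n (i.e., i ∈ n), as the last term of the
   internal sequence S of its partial sums. *)
Definition hsum (n : V) (g : V -> G) : G :=
  xget 0 [set v | exists (m : V) (S : V -> G),
    [/\ is_succ n m, internal_seq m (icoding G \o S),
        forall e, is_empty e -> S e = 0,
        forall i j, i ∈ n -> is_succ i j -> S j = S i + g i
      & v = S n]].

Definition simplex (p : nat) := 'I_p.+1 -> V.

(* A formal sum of p-simplices is identified with its coefficient function. *)
Definition chain (p : nat) := simplex p -> G.

Definition elem (p : nat) (a : simplex p) : simplex p -> int :=
  fun t => (nat_of_bool `[< t = a >])%:Z.

(* (g i) and (sigma i), i < n, are internal hyperfinite sequences.  As p is a
   standard natural number, a sequence of (p+1)-tuples is internal iff its
   coordinate sequences are.  The length n may be 0, so that 0 is a chain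
   even in the absence of simplices. *)
Definition hyperfinite_seq (p : nat) (n : V) (g : V -> G)
    (sigma : V -> simplex p) :=
  [/\ is_nat n, internal_seq n (icoding G \o g)
    & forall k, internal_seq n (fun i => sigma i k)].

Definition formal_sum (p : nat) (n : V) (g : V -> G)
    (w : V -> simplex p -> int) : chain p :=
  fun t => hsum n (fun i => g i *~ w i t).

(* The extension to hyperfinite formal sums of a map u from p-simplices to
   integral q-chains: sum g_i sigma_i |-> sum g_i u(sigma_i).  For the maps u
   used below, c' does not depend on the representation of c; the default 0 is
   only taken on functions c that are not hyperfinite formal sums. *)
Definition hyperlinear (p q : nat) (u : simplex p -> simplex q -> int)
    (c : chain p) : chain q :=
  xget 0 [set c' | exists n g sigma,
    [/\ hyperfinite_seq n g sigma, c = formal_sum n g (fun i => elem (sigma i))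
      & c' = formal_sum n g (fun i => u (sigma i))]].

Definition face (p : nat) (j : 'I_p.+2) (a : simplex p.+1) : simplex p :=
  fun k => a (lift j k).

Definition boundary (p : nat) : chain p.+1 -> chain p :=
  hyperlinear (fun a t => \sum_(j < p.+2) (-1) ^+ j * elem (face j a) t).

End Chains.

Definition is_subgroup (Z : zmodType) (S : set Z) :=
  S 0 /\ forall x y, S x -> S y -> S (x - y).

(* F induces a homomorphism S / S0 -> T / T0. *)
Definition is_hom (Z W : zmodType) (S S0 : set Z) (T T0 : set W)
    (F : Z -> W) :=
  [/\ forall x, S x -> T (F x), forall x, S0 x -> T0 (F x)
    & forall x y, S x -> S y -> T0 (F (x + y) - (F x + F y))].

(* The complex with groups num p / den p, given by representatives in amb p. *)
Record complex := Complex {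
  amb : nat -> zmodType;
  num : forall p, set (amb p);
  den : forall p, set (amb p);
  bd : forall p, amb p.+1 -> amb p }.
Arguments num : clear implicits.
Arguments den : clear implicits.
Arguments bd : clear implicits.
Arguments bd C {p} x : rename.

Definition is_complex (C : complex) :=
  (forall p, [/\ is_subgroup (num C p), is_subgroup (den C p)
               & den C p `<=` num C p]) /\
  (forall p, is_hom (num C p.+1) (den C p.+1) (num C p) (den C p) (bd C)) /\
  (forall p x, num C p.+2 x -> den C p (bd C (bd C x))).

Section ComplexMaps.
Variables C D : complex.
Implicit Types F H : forall p, amb C p -> amb D p.

Definition is_chain_map F :=
  (forall p, is_hom (num C p) (den C p) (num D p) (den D p) (F p)) /\
  (forall p x, num C p.+1 x -> den D p (bd D (F p.+1 x) - F p (bd C x))).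

(* Equalities hold in num D p / den D p. *)
Definition chain_homotopic F H :=
  exists P : forall p, amb C p -> amb D p.+1,
  [/\ forall p, is_hom (num C p) (den C p) (num D p.+1) (den D p.+1) (P p),
      forall x, num C 0 x -> den D 0 (bd D (P 0%N x) - (H 0%N x - F 0%N x))
    & forall p x, num C p.+1 x ->
        den D p.+1 (bd D (P p.+1 x) + P p (bd C x) - (H p.+1 x - F p.+1 x))].

End ComplexMaps.

Definition cycles (C : complex) (p : nat) : set (amb C p) :=
  match p with
  | 0 => num C 0
  | q.+1 => [set x | num C q.+1 x /\ den C q (bd C x)]
  end.
Arguments cycles : clear implicits.

Definition bounding (C : complex) (p : nat) : set (amb C p) :=
  [set x | num C p x /\ exists2 y, num C p.+1 y & den C p (x - bd C y)].
Arguments bounding : clear implicits.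

Definition coset (Z : zmodType) (B : set Z) (x : Z) : set Z :=
  [set y | B (y - x)].

(* The elements of the p-th homology group: cosets of the boundaries. *)
Definition homology (C : complex) (p : nat) : set (set (amb C p)) :=
  [set coset (bounding C p) z | z in cycles C p].
Arguments homology : clear implicits.

(* [z] |-> [F z] *)
Definition homology_map (C D : complex) (F : forall p, amb C p -> amb D p)
    (p : nat) (xi : set (amb C p)) : set (amb D p) :=
  \bigcup_(z in xi) coset (bounding D p) (F p z).

Section Microchains.
Variables (N : nonstandard_universe) (G : internal_group (int_univ N)).

Definition microsimplex (X : uniformType) (cX : coding (std_univ N) X) (p : nat)
    (a : simplex (int_univ N) p) :=
  (forall k, a k ∈ star (cset cX)) /\
  (forall k l, infinitely_close cX (a k) (a l)).

Definition microchain (X : uniformType) (cX : coding (std_univ N) X) (p : nat) :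
    set (chain G p) :=
  [set c | exists n g sigma,
    [/\ hyperfinite_seq n g sigma,
        forall i, i ∈ n -> microsimplex cX (sigma i)
      & c = formal_sum n g (fun i => elem (sigma i))]].

Definition microcomplex (X : uniformType) (cX : coding (std_univ N) X) : complex :=
  @Complex (fun p => chain G p : zmodType) (fun p => microchain cX (p := p))
    (fun p => [set 0]) (fun p => @boundary _ G p).

Definition rel_microcomplex (X : uniformType) (cX : coding (std_univ N) X)
    (A : set X) : complex :=
  @Complex (fun p => chain G p : zmodType) (fun p => microchain cX (p := p))
    (fun p => microchain (X := A) (sub_coding (std_zermelo N) cX A) (p := p))
    (fun p => @boundary _ G p).

Definition micromap (X Y : uniformType) (cX : coding (std_univ N) X)
    (cY : coding (std_univ N) Y) (f : X -> Y) (p : nat) : chain G p -> chain G p :=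
  hyperlinear (fun a => elem (star_fun cX cY f \o a)).

End Microchains.
Arguments micromap {N} G {X Y} cX cY f p c.

Section Homotopy.
Variables (R : realType) (X Y : uniformType).
Local Notation I01 := (`[0, 1]%classic : set R).

(* The set I01, used as a type, carries the uniformity induced by R. *)
Definition is_unif_homotopy (f g : X -> Y) (h : X * I01 -> Y) :=
  unif_continuous h /\
  (forall (x : X) (t : I01), (set_val t = 0 -> h (x, t) = f x) /\
                             (set_val t = 1 -> h (x, t) = g x)).

Definition unif_homotopic (f g : X -> Y) :=
  exists h, is_unif_homotopy f g h.

Definition unif_homotopic_pairs (A : set X) (B : set Y) (f g : X -> Y) :=
  exists2 h, is_unif_homotopy f g h &
    forall (x : X) (t : I01), A x -> B (h (x, t)).

End Homotopy.

(* Main.v *)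
(** Subdivide [0, 1] into m equal steps, m an infinite hypernatural, and let
  eta j = *h(-, j/m), so that eta 0 = *f and eta m = *g.  As h is uniformly
  continuous and 1/m is infinitesimal, infinitely close points have infinitely
  close images under eta j and eta (j + 1); hence the classical prism operator
  between eta j and eta (j + 1) sends microchains to microchains.  Its boundary
  formula gives the increment from eta j to eta (j + 1), and the sum over j < m,
  a hyperfinite sum of microchains, telescopes to a homotopy from f to g.

  Hyperfinite sums are handled by internal induction, which is available for
  predicates definable from internal parameters. *)

Require Import Defs.
From mathcomp Require Import all_boot all_order all_algebra.
From mathcomp Require Import all_classical all_reals all_analysis.
From mathcomp Require Import zify ring lra.
Import Defs.

Set Implicit Arguments.
Unset Strict Implicit.
Unset Printing Implicit Defensive.
Import Order.TTheory GRing.Theory Num.Theory.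
Import numFieldNormedType.Exports.
Local Open Scope classical_set_scope.
Local Open Scope ring_scope.


(** * Definability *)

(** Sums of nonstandard length are reached only by internal induction, so every function that enters
    such a sum has to be definable from internal parameters; [dP], [dF], [dG] and [dS] track this
    through all constructions. Two obstacles shape the rest. Simplices are functions of the
    metatheory, hence they are coded by elements of [V] whenever an induction has to speak about all
    of them. And being a microsimplex is external, so induction on the number of summands cannot
    show that a hyperfinite sum of microchains is a microchain. Instead the induction produces one
    internal sequence that lists all the terms and records from which indices each of them comes;
    the external property is then checked term by term. That a map of simplices extends to formal
    sums, whatever the representation, rests on grouping the coefficients by the simplex that they
    multiply. The infinite [m] is a gift of saturation, and its defining property, to exceed every
    standard numeral, is what makes the grid fine enough for all entourages at once. *)

Fixpoint fren (r : nat -> nat) (phi : form) : form :=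
  match phi with
  | FMem i j => FMem (r i) (r j)
  | FEq i j => FEq (r i) (r j)
  | FNot p => FNot (fren r p)
  | FAnd p q => FAnd (fren r p) (fren r q)
  | FAll p => FAll (fren (scons 0%N (S \o r)) p)
  end.

Lemma sat_fren (M : mstruct) phi r (e : nat -> M) :
  sat e (fren r phi) <-> sat (e \o r) phi.
Proof.
elim: phi r e => [i j|i j|p IH|p IHp q IHq|p IH] r e //=.
- by rewrite IH.
- by rewrite IHp IHq.
- suff H x : sat (scons x e) (fren (scons 0%N (S \o r)) p) <->
             sat (scons x (e \o r)) p by split=> h x; apply/H.
  by rewrite IH; suff -> : scons x e \o scons 0%N (S \o r) = scons x (e \o r)
    by []; apply/funext => -[|n].
Qed.

Fixpoint fsize (phi : form) : nat :=
  match phi with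
  | FMem i j | FEq i j => (maxn i j).+1
  | FNot p | FAll p => fsize p
  | FAnd p q => maxn (fsize p) (fsize q)
  end.

Lemma sat_ext (M : mstruct) phi (e e' : nat -> M) :
  (forall n, (n < fsize phi)%N -> e n = e' n) -> sat e phi <-> sat e' phi.
Proof.
elim: phi e e' => [i j|i j|p IH|p IHp q IHq|p IH] e e' /= he.
- by rewrite !he // ltnS leq_max leqnn ?orbT.
- by rewrite !he // ltnS leq_max leqnn ?orbT.
- by rewrite (IH _ e').
- rewrite (IHp _ e') ?(IHq _ e') // => n hn; apply: he;
    by rewrite leq_max hn ?orbT.
- suff H x : sat (scons x e) p <-> sat (scons x e') p by split=> h x; apply/H.
  by apply: IH => -[|n] //= hn; apply: he; apply: ltnW.
Qed.

Lemma sat_ext_imp (M : mstruct) phi (e e' : nat -> M) :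
  (forall n, (n < fsize phi)%N -> e n = e' n) -> sat e phi -> sat e' phi.
Proof. by move=> h /(sat_ext h). Qed.

Fixpoint fclose (k : nat) (phi : form) : form :=
  if k is k'.+1 then FAll (fclose k' phi) else phi.

Lemma sat_fclose (M : mstruct) k phi (e : nat -> M) :
  sat e (fclose k phi) <->
  forall a : nat -> M, sat (fun n => if (n < k)%N then a n else e (n - k)%N) phi.
Proof.
elim: k e => [|k IH] e /=.
  split=> [h a|/(_ e)].
    by move: h; apply: sat_ext_imp => n _; rewrite ?ltn0 /= ?subn0.
  by apply: sat_ext_imp => n _; rewrite ?ltn0 /= ?subn0.
split=> [h a|h x].
  move/IH: (h (a k)) => /(_ a); apply: sat_ext_imp => n _.
  case: (ltngtP n k) => nk; rewrite ?ltnS.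
  - by rewrite (ltnW nk).
  - by rewrite leqNgt nk /=; have -> : (n - k)%N = (n - k.+1).+1 by lia.
  - by rewrite nk leqnn subnn.
apply/IH => a; move: (h (fun n => if (n < k)%N then a n else x)).
apply: sat_ext_imp => n _; case: (ltngtP n k) => nk; rewrite ?ltnS.
- by rewrite (ltnW nk).
- by rewrite leqNgt nk /=; have -> : (n - k)%N = (n - k.+1).+1 by lia.
- by rewrite nk leqnn subnn.
Qed.

(* Predicates definable uniformly over a family of structures, the parameters
   being families subject to K.  The family (U, *U) with parameters (u, *u)
   yields transfer; a single structure with arbitrary parameters yields
   internal separation and induction. *)
Section Definability.
Variables (I : Type) (M : I -> mstruct) (K : (forall i, M i) -> Prop).
Implicit Types (P Q : forall i, (nat -> M i) -> Prop)
  (s t u : forall i, (nat -> M i) -> M i).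

Definition penv (r : nat -> nat + {c | K c}) i (e : nat -> M i) : nat -> M i :=
  fun n => match r n with inl k => e k | inr c => sval c i end.

(** The formula and its routing are chosen before [i], which is what lets one definition be
    transferred between two universes. Formulas have no constants, so parameters enter through the
    variables that [r] routes to them. *)
Definition dP P := exists phi r, forall i e, P i e <-> sat (penv r e) phi.

Definition dF t := dP (fun i e => e 0%N = t i (fun n => e n.+1)).

Lemma dP_ext P Q : (forall i e, P i e <-> Q i e) -> dP P -> dP Q.
Proof. by move=> h [phi [r H]]; exists phi, r => i e; rewrite -h. Qed.

Lemma dP_not P : dP P -> dP (fun i e => ~ P i e).
Proof. by move=> [phi [r H]]; exists (FNot phi), r => i e /=; rewrite H. Qed.

Lemma dP_and P Q : dP P -> dP Q -> dP (fun i e => P i e /\ Q i e).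
Proof.
move=> [phi [r H]] [psi [q H']].
(* The two formulas may route the same variable differently; the first is moved to the even
   variables and the second to the odd ones. *)
exists (FAnd (fren double phi) (fren (S \o double) psi)),
  (fun n => if odd n then q n./2 else r n./2) => i e /=.
rewrite !sat_fren H H'.
set e1 := _ \o double; set e2 := _ \o (S \o double).
have -> : e1 = penv r e
  by apply/funext => n; rewrite /e1 /penv /= odd_double doubleK.
have -> // : e2 = penv q e.
by apply/funext => n; rewrite /e2 /penv /= odd_double /= uphalf_double.
Qed.

Lemma dP_all (Q : forall i, M i -> (nat -> M i) -> Prop) :
  dP (fun i e => Q i (e 0%N) (fun n => e n.+1)) ->
  dP (fun i e => forall x, Q i x e).
Proof.
move=> [phi [r H]].
(* Every variable routed to the quantified [e 0] is renamed to the bound variable 0; the others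
   shift by one, and their routes into [e] drop by one. *)
exists (FAll (fren (fun n => if r n is inl 0%N then 0%N else n.+1) phi)),
  (fun n => if r n is inl k then inl k.-1 else r n) => i e /=.
have E x : Q i x e <-> sat (penv r (scons x e)) phi by rewrite -H.
suff E' x : Q i x e <-> sat
    (scons x (penv (fun n => if r n is inl k then inl k.-1 else r n) e))
    (fren (fun n => if r n is inl 0%N then 0%N else n.+1) phi).
  by split=> h x; [apply: (proj1 (E' x)) | apply: (proj2 (E' x))].
rewrite E sat_fren; set e1 := penv _ _; set e2 := _ \o _.
suff -> : e1 = e2 by [].
by apply/funext => n; rewrite /e1 /e2 /penv /=; case E0: (r n) => [[|k]|c] //=; rewrite E0.
Qed.

Lemma dP_ren P (f : nat -> nat) : dP P -> dP (fun i e => P i (fun n => e (f n))).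
Proof.
move=> [phi [r H]].
exists phi, (fun n => if r n is inl k then inl (f k) else r n) => i e.
rewrite H; set e1 := penv _ _; set e2 := penv _ _; suff -> : e1 = e2 by [].
by apply/funext => n; rewrite /e1 /e2 /penv; case: (r n).
Qed.

Lemma dP_or P Q : dP P -> dP Q -> dP (fun i e => P i e \/ Q i e).
Proof.
move=> hP hQ; apply: (@dP_ext (fun i e => ~ (~ P i e /\ ~ Q i e))).
  by move=> i e; have [] := pselect (P i e); have [] := pselect (Q i e); tauto.
by apply/dP_not/dP_and; apply/dP_not.
Qed.

Lemma dP_imp P Q : dP P -> dP Q -> dP (fun i e => P i e -> Q i e).
Proof.
move=> hP hQ; apply: (@dP_ext (fun i e => ~ P i e \/ Q i e)).
  by move=> i e; have [] := pselect (P i e); tauto.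
by apply/dP_or => //; apply/dP_not.
Qed.

Lemma dP_iff P Q : dP P -> dP Q -> dP (fun i e => P i e <-> Q i e).
Proof. by move=> hP hQ; apply: dP_and; apply: dP_imp. Qed.

Lemma dP_ex (Q : forall i, M i -> (nat -> M i) -> Prop) :
  dP (fun i e => Q i (e 0%N) (fun n => e n.+1)) ->
  dP (fun i e => exists x, Q i x e).
Proof.
move=> hQ; apply: (@dP_ext (fun i e => ~ forall x, ~ Q i x e)).
  by move=> i e; rewrite forallNE notK.
by apply/dP_not/dP_all/dP_not.
Qed.

Lemma dP_prop (p : Prop) : dP (fun _ _ => p).
Proof.
case: (pselect p) => hp.
  by exists (FEq 0 0), inl.
by exists (FNot (FEq 0 0)), inl => i e /=; split=> // /(_ erefl).
Qed.

Lemma dP_fall (B : finType) (Q : B -> forall i, (nat -> M i) -> Prop) :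
  (forall b, dP (Q b)) -> dP (fun i e => forall b, Q b i e).
Proof.
move=> hQ.
suff H (l : seq B) : dP (fun i e => forall b, b \in l -> Q b i e).
  apply: dP_ext (H (enum B)) => i e.
  by split=> [h b|h b _]; apply: h; rewrite mem_enum.
elim: l => [|a l IH]; first by apply: dP_ext (dP_prop True).
apply: dP_ext (dP_and (hQ a) IH) => i e; split=> [[h1 h2] b|h].
  by rewrite inE => /orP[/eqP ->|/h2].
by split; [|move=> b hb]; apply: h; rewrite inE ?eqxx ?hb ?orbT.
Qed.

Lemma dF_ext s t : (forall i e, s i e = t i e) -> dF s -> dF t.
Proof. by move=> h; apply: dP_ext => i e; rewrite h. Qed.

Lemma dF_var n : dF (fun i e => e n).
Proof. by exists (FEq 0 n.+1), inl. Qed.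

Lemma dF_const c : K c -> dF (fun i _ => c i).
Proof.
move=> Kc; exists (FEq 0 1), (fun n => if n is 0%N then inl 0%N
  else inr (exist K c Kc)) => i e.
by rewrite /penv /=.
Qed.

(** The language has no function symbols, so a definable term is substituted through an existential
    quantifier over its value. *)
Lemma dP_sub1 (Q : forall i, M i -> Prop) t :
  dP (fun i e => Q i (e 0%N)) -> dF t -> dP (fun i e => Q i (t i e)).
Proof.
move=> hQ ht; apply: (@dP_ext (fun i e => exists x, x = t i e /\ Q i x)).
  by move=> i e; split=> [[x [-> //]]|h]; exists (t i e).
by apply: dP_ex; apply: dP_and.
Qed.

Lemma dP_sub2 (Q : forall i, M i -> M i -> Prop) s t :
  dP (fun i e => Q i (e 0%N) (e 1%N)) -> dF s -> dF t ->
  dP (fun i e => Q i (s i e) (t i e)).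
Proof.
move=> hQ hs ht.
apply: (@dP_ext (fun i e => exists x, x = s i e /\ exists y, y = t i e /\ Q i x y)).
  move=> i e; split=> [[x [-> [y [-> //]]]]|h].
  by exists (s i e); split=> //; exists (t i e).
apply: dP_ex; apply: dP_and => //; apply: dP_ex; apply: dP_and.
  exact: (dP_ren (fun n => if n is 0%N then 0%N else n.+1) ht).
exact: (dP_ren (fun n => if n is 0%N then 1%N else 0%N) hQ).
Qed.

Lemma dP_sub3 (Q : forall i, M i -> M i -> M i -> Prop) s t u :
  dP (fun i e => Q i (e 0%N) (e 1%N) (e 2%N)) -> dF s -> dF t -> dF u ->
  dP (fun i e => Q i (s i e) (t i e) (u i e)).
Proof.
move=> hQ hs ht hu.
apply: (@dP_ext (fun i e => exists x, x = s i e /\ exists y, y = t i e /\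
   exists z, z = u i e /\ Q i x y z)).
  move=> i e; split=> [[x [-> [y [-> [z [-> //]]]]]]|h].
  by exists (s i e); split=> //; exists (t i e); split=> //; exists (u i e).
apply: dP_ex; apply: dP_and => //; apply: dP_ex; apply: dP_and.
  exact: (dP_ren (fun n => if n is 0%N then 0%N else n.+1) ht).
apply: dP_ex; apply: dP_and.
  exact: (dP_ren (fun n => if n is 0%N then 0%N else n.+2) hu).
exact: (dP_ren (fun n => match n with 0%N => 2%N | 1%N => 1%N | _ => 0%N end) hQ).
Qed.

Lemma dP_eq s t : dF s -> dF t -> dP (fun i e => s i e = t i e).
Proof. by apply: (@dP_sub2 (fun i x y => x = y)); exists (FEq 0 1), inl. Qed.

Lemma dP_mem s t : dF s -> dF t -> dP (fun i e => s i e ∈ t i e).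
Proof. by apply: (@dP_sub2 (fun i x y => x ∈ y)); exists (FMem 0 1), inl. Qed.

Lemma dF_sub1 (F : forall i, M i -> M i) t :
  dF (fun i e => F i (e 0%N)) -> dF t -> dF (fun i e => F i (t i e)).
Proof.
move=> hF ht; apply: (@dP_sub2 (fun i x y => x = F i y) (fun i e => e 0%N)
  (fun i e => t i (fun n => e n.+1))).
- exact: hF.
- exact: dF_var.
- exact: (dP_ren (fun n => if n is 0%N then 0%N else n.+1) ht).
Qed.

Lemma dF_sub2 (F : forall i, M i -> M i -> M i) s t :
  dF (fun i e => F i (e 0%N) (e 1%N)) -> dF s -> dF t ->
  dF (fun i e => F i (s i e) (t i e)).
Proof.
move=> hF hs ht; apply: (@dP_sub3 (fun i x y z => x = F i y z) (fun i e => e 0%N)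
  (fun i e => s i (fun n => e n.+1)) (fun i e => t i (fun n => e n.+1))).
- exact: hF.
- exact: dF_var.
- exact: (dP_ren (fun n => if n is 0%N then 0%N else n.+1) hs).
- exact: (dP_ren (fun n => if n is 0%N then 0%N else n.+1) ht).
Qed.

Lemma dF_if P s t : dP P -> dF s -> dF t ->
  dF (fun i e => if `[< P i e >] then s i e else t i e).
Proof.
move=> hP hs ht; apply: (@dP_ext (fun i e =>
  let e' := fun n => e n.+1 in
  (P i e' /\ e 0%N = s i e') \/ (~ P i e' /\ e 0%N = t i e'))).
  move=> i e /=; case: asboolP => h; split; tauto.
by apply: dP_or; apply: dP_and => //; [|apply: dP_not]; exact: (dP_ren S hP).
Qed.

End Definability.

Lemma dP_upair I (M : I -> mstruct) K (s t u : forall i, (nat -> M i) -> M i) :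
  dF K s -> dF K t -> dF K u ->
  dP K (fun i e => is_upair (s i e) (t i e) (u i e)).
Proof.
apply: (@dP_sub3 _ _ _ (fun i => @is_upair (M i))).
apply: dP_all; apply: dP_iff; first by apply: dP_mem; apply: dF_var.
by apply: dP_or; apply: dP_eq; apply: dF_var.
Qed.

(* [dF] unfolds to [dP] of an equation, on which [dP_eq] would loop. *)
Ltac dp1 := cbv beta; first [ assumption | lazymatch goal with
  | |- dF _ _ => apply: dF_var
  | |- dP _ _ => first
    [ apply: dP_prop
    | apply: dP_upair | apply: dP_mem | apply: dP_eq
    | apply: dP_not | apply: dP_iff | apply: dP_and | apply: dP_or | apply: dP_imp
    | apply: dP_all | apply: dP_ex ] end ].

Section DefinableNotions.
Variables (I : Type) (M : I -> mstruct) (K : (forall i, M i) -> Prop).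
Implicit Types (s t u : forall i, (nat -> M i) -> M i).

Lemma dP_pair s t u : dF K s -> dF K t -> dF K u ->
  dP K (fun i e => is_pair (s i e) (t i e) (u i e)).
Proof. by apply: (@dP_sub3 _ _ _ (fun i => @is_pair (M i))); repeat dp1. Qed.

Lemma dP_empty s : dF K s -> dP K (fun i e => is_empty (s i e)).
Proof. by apply: (@dP_sub1 _ _ _ (fun i => @is_empty (M i))); repeat dp1. Qed.

Lemma dP_succ s t : dF K s -> dF K t -> dP K (fun i e => is_succ (s i e) (t i e)).
Proof. by apply: (@dP_sub2 _ _ _ (fun i => @is_succ (M i))); repeat dp1. Qed.

End DefinableNotions.

Ltac dp2 := cbv beta; first
  [ lazymatch goal with |- dP _ _ => first
      [apply: dP_pair | apply: dP_empty | apply: dP_succ] end | dp1 ].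

Section DefinableNotions2.
Variables (I : Type) (M : I -> mstruct) (K : (forall i, M i) -> Prop).
Implicit Types (s t u : forall i, (nat -> M i) -> M i).

Lemma dP_pair_in s t u : dF K s -> dF K t -> dF K u ->
  dP K (fun i e => pair_in (s i e) (t i e) (u i e)).
Proof. by apply: (@dP_sub3 _ _ _ (fun i => @pair_in (M i))); repeat dp2. Qed.

Lemma dP_nat s : dF K s -> dP K (fun i e => is_nat (s i e)).
Proof. by apply: (@dP_sub1 _ _ _ (fun i => @is_nat (M i))); repeat dp2. Qed.

End DefinableNotions2.

Ltac dp3 := cbv beta; first
  [ lazymatch goal with |- dP _ _ => first
      [apply: dP_pair_in | apply: dP_nat] end | dp2 ].

(** * Elementary set theory *)

(** The part of [zermelo] that single formulas express. It transfers to the internal universe,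
    whereas separation over all predicates of the metatheory does not. *)
Record pairing_structure (M : mstruct) : Prop := PairingStructure {
  ps_ext : forall x y : M, (forall z, z ∈ x <-> z ∈ y) -> x = y;
  ps_upair : forall x y : M, exists w, is_upair w x y;
  ps_adjoin : forall x y : M, exists z, forall w, w ∈ z <-> w ∈ x \/ w = y;
  ps_empty : exists x : M, is_empty x }.

Lemma zermelo_pairing_structure (M : mstruct) : zermelo M -> pairing_structure M.
Proof.
move=> zM; split; [exact: extensionality|exact: pairing| |].
- move=> x y; have [s hs] := pairing zM y y; have [p hp] := pairing zM x s.
  have [u hu] := union zM p; exists u => w; rewrite hu.
  split=> [[z wz /hp[]zE]|[wx|->]].
  + by left; rewrite -zE.
  + by right; move: wz; rewrite zE => /hs[].
  + by exists x => //; apply/hp; left.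
  + by exists s; [apply/hs; left | apply/hp; right].
- by have [w [[e he _] _]] := infinity zM; exists e.
Qed.

Section Pairs.
Variables (M : mstruct) (psM : pairing_structure M).
Implicit Types x y z w : M.

Lemma upair_uniq w w' x y : is_upair w x y -> is_upair w' x y -> w = w'.
Proof. by move=> h h'; apply: (ps_ext psM) => z; rewrite h h'. Qed.

Lemma pair_uniq w w' x y : is_pair w x y -> is_pair w' x y -> w = w'.
Proof. by move=> h h'; apply: (ps_ext psM) => z; rewrite h h'. Qed.

Lemma succ_uniq s s' x : is_succ x s -> is_succ x s' -> s = s'.
Proof. by move=> h h'; apply: (ps_ext psM) => z; rewrite h h'. Qed.

Lemma empty_uniq x y : is_empty x -> is_empty y -> x = y.
Proof.
by move=> h h'; apply: (ps_ext psM) => z; split=> [/h|/h'].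
Qed.

Lemma pair_inj w x y x' y' :
  is_pair w x y -> is_pair w x' y' -> x = x' /\ y = y'.
Proof.
move=> h h'.
have [s hs] := ps_upair psM x x; have [t ht] := ps_upair psM x y.
have [t' ht'] := ps_upair psM x' y'.
have xx : x = x'.
  have /h' : s ∈ w by apply/h; left.
  by case=> sE; have /hs[] : x' ∈ s by apply/sE; left.
subst x'; split=> //.
have h1 : y' = x \/ y' = y.
  have /h : t' ∈ w by apply/h'; right.
  by case=> tE; have /tE[] : y' ∈ t' by [apply/ht'; right|]; auto.
have h2 : y = x \/ y = y'.
  have /h' : t ∈ w by apply/h; right.
  by case=> tE; have /tE[] : y ∈ t by [apply/ht; right|]; auto.
by case: h1 h2 => -> [].
Qed.

Lemma pair_exists x y : exists w, is_pair w x y.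
Proof.
have [s hs] := ps_upair psM x x; have [t ht] := ps_upair psM x y.
have [w hw] := ps_upair psM s t; exists w => z; rewrite hw.
by split=> [[]->|[] h]; [left|right|left|right] => //; exact: upair_uniq h _.
Qed.

Definition kpair x y : M := projT1 (cid (pair_exists x y)).

Lemma kpairP x y : is_pair (kpair x y) x y.
Proof. by rewrite /kpair; case: cid. Qed.

Lemma is_pairE w x y : is_pair w x y <-> w = kpair x y.
Proof. by split=> [h|->]; [apply: pair_uniq h (kpairP _ _)|apply: kpairP]. Qed.

Lemma kpair_inj x y x' y' : kpair x y = kpair x' y' -> x = x' /\ y = y'.
Proof. by move=> E; apply: pair_inj (kpairP x y) _; rewrite E; apply: kpairP. Qed.

Lemma pair_inE f x y : pair_in f x y <-> kpair x y ∈ f.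
Proof.
split=> [[w [wf /is_pairE <-]]//|h]; exists (kpair x y); split=> //.
exact: kpairP.
Qed.

Definition zero : M := projT1 (cid (ps_empty psM)).

Lemma zeroP : is_empty zero.
Proof. by rewrite /zero; case: cid. Qed.

Lemma is_emptyE x : is_empty x <-> x = zero.
Proof. by split=> [h|->]; [apply: empty_uniq h zeroP|apply: zeroP]. Qed.

Definition adjoin x y : M := projT1 (cid (ps_adjoin psM x y)).

Lemma adjoinP x y w : w ∈ adjoin x y <-> w ∈ x \/ w = y.
Proof. by rewrite /adjoin; case: cid. Qed.

Definition succ x : M := adjoin x x.

Lemma succP x w : w ∈ succ x <-> w ∈ x \/ w = x.
Proof. exact: adjoinP. Qed.

Lemma is_succE x s : is_succ x s <-> s = succ x.
Proof.
have H : is_succ x (succ x) by move=> z; rewrite succP.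
by split=> [h|->//]; apply: succ_uniq h H.
Qed.

Lemma is_nat_zero : is_nat zero.
Proof. by move=> w [h _]; apply: h; apply: zeroP. Qed.

Lemma is_nat_succ n : is_nat n -> is_nat (succ n).
Proof.
by move=> hn w hw; apply: (proj2 hw n); [apply: hn|apply/is_succE].
Qed.

Definition fst_of w : M := @xget {classic M} zero [set x | exists y, w = kpair x y].
Definition snd_of w : M := @xget {classic M} zero [set y | exists x, w = kpair x y].

Lemma fst_kpair x y : fst_of (kpair x y) = x.
Proof.
rewrite /fst_of; case: xgetP => [z _ [y' /kpair_inj[]//]|/(_ x)/= h].
by case: h; exists y.
Qed.

Lemma snd_kpair x y : snd_of (kpair x y) = y.
Proof.
rewrite /snd_of; case: xgetP => [z _ [y' /kpair_inj[]//]|/(_ y)/= h].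
by case: h; exists x.
Qed.

(* The empty set unless f relates x to exactly one element. *)
Definition app f x : M :=
  @xget {classic M} zero [set y | pair_in f x y /\ forall y', pair_in f x y' -> y' = y].

Lemma appE f x y :
  pair_in f x y -> (forall y', pair_in f x y' -> y' = y) -> app f x = y.
Proof.
move=> h h'; rewrite /app; case: xgetP => [z _ [/h' //]|/(_ y)/= H].
by case: H.
Qed.

Definition internal_property (P : M -> Prop) :=
  @dP unit (fun=> M) (fun=> True) (fun _ e => P (e 0%N)).

Notation dV := (@dP unit (fun=> M) (fun=> True)).
Notation dT := (@dF unit (fun=> M) (fun=> True)).

Lemma dT_const (c : M) : dT (fun _ _ => c).
Proof. exact: (@dF_const _ _ _ (fun=> c)). Qed.

(** With at most one witness, [xget] makes no real choice: its value is either that witness or the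
    default [c], and both alternatives are formulas. *)
Lemma dT_xget (c : M) (Q : M -> (nat -> M) -> Prop) :
  dV (fun _ e => Q (e 0%N) (fun n => e n.+1)) ->
  (forall e x y, Q x e -> Q y e -> x = y) ->
  dT (fun _ e => @xget {classic M} c [set y | Q y e]).
Proof.
move=> hQ uQ.
apply: (@dP_ext _ _ _ (fun _ e => Q (e 0%N) (fun n => e n.+1) \/
  (~ (exists y, Q y (fun n => e n.+1)) /\ e 0%N = c))).
  move=> _ e; case: xgetP => [z _ /= hz|/= h].
    split=> [[h|[[]]]|->]; [exact: uQ h hz|by exists z|by left].
  by split=> [[/h//|[_ ->//]]|->]; right; split=> // -[y /h].
repeat dp3; last exact: dT_const.
exact: (dP_ren (fun n => if n is 0%N then 0%N else n.+1) hQ).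
Qed.

Lemma dT_kpair (s t : unit -> (nat -> M) -> M) : dT s -> dT t ->
  dT (fun i e => kpair (s i e) (t i e)).
Proof.
apply: (@dF_sub2 _ _ _ (fun _ x y => kpair x y)).
apply: (@dP_ext _ _ _ (fun _ e => is_pair (e 0%N) (e 1%N) (e 2%N))).
  by move=> _ e; apply: is_pairE.
by repeat dp3.
Qed.

Lemma dT_succ (s : unit -> (nat -> M) -> M) : dT s ->
  dT (fun i e => succ (s i e)).
Proof.
apply: (@dF_sub1 _ _ _ (fun _ x => succ x)).
apply: (@dP_ext _ _ _ (fun _ e => is_succ (e 1%N) (e 0%N))).
  by move=> _ e; apply: is_succE.
by repeat dp3.
Qed.

Lemma dT_fst (s : unit -> (nat -> M) -> M) : dT s ->
  dT (fun i e => fst_of (s i e)).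
Proof.
apply: (@dF_sub1 _ _ _ (fun _ x => fst_of x)).
apply: (@dT_xget _ (fun x e => exists y, e 0%N = kpair x y)).
  by repeat (first [apply: dT_kpair|dp3]).
by move=> e x y [? ->] [? /kpair_inj[]].
Qed.

Lemma dT_snd (s : unit -> (nat -> M) -> M) : dT s ->
  dT (fun i e => snd_of (s i e)).
Proof.
apply: (@dF_sub1 _ _ _ (fun _ x => snd_of x)).
apply: (@dT_xget _ (fun y e => exists x, e 0%N = kpair x y)).
  by repeat (first [apply: dT_kpair|dp3]).
by move=> e x y [? ->] [? /kpair_inj[]].
Qed.

Lemma dT_app (s t : unit -> (nat -> M) -> M) : dT s -> dT t ->
  dT (fun i e => app (s i e) (t i e)).
Proof.
apply: (@dF_sub2 _ _ _ (fun _ f x => app f x)).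
apply: (@dT_xget _ (fun y e => pair_in (e 0%N) (e 1%N) y /\
   forall y', pair_in (e 0%N) (e 1%N) y' -> y' = y)).
  by repeat dp3.
by move=> e x y [h _] [_]; apply.
Qed.

End Pairs.

Notation dV M := (@dP unit (fun=> M) (fun=> True)).
Notation dT M := (@dF unit (fun=> M) (fun=> True)).

Ltac dp4 := cbv beta; first
  [ lazymatch goal with |- dF _ _ => first
      [ apply: dT_const | apply: dT_kpair | apply: dT_succ | apply: dT_fst
      | apply: dT_snd | apply: dT_app ] end | dp3 ].

(** * Transfer and internal induction *)

Section Transfer.
Variable N : nonstandard_universe.
Local Notation U := (std_univ N).
Local Notation V := (int_univ N).

Definition two_univ (b : bool) : mstruct := if b then V else U.

Definition star_param (c : forall b, two_univ b) : Prop :=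
  c true = star (c false : U) :> V.

Lemma transfer (P : forall b, (nat -> two_univ b) -> Prop) (e : nat -> U) :
  dP star_param P -> P false e <-> P true (fun n => star (e n) : V).
Proof.
move=> [phi [r H]]; rewrite !H (star_elementary phi (penv r (e : nat -> two_univ false))).
set e1 := _ \o _; set e2 := penv _ _; suff -> : e1 = e2 by [].
by apply/funext => n; rewrite /e1 /e2 /penv /=; case: (r n) => [//|[c hc]] /=.
Qed.

Definition no_param (c : forall b, two_univ b) : Prop := False.

(** Elementarity compares assignments of the form [star \o e]. To reach arbitrary internal
    assignments, the formula is closed under universal quantifiers, and the resulting sentence is
    transferred. *)
Lemma transfer_valid (P : forall b, (nat -> two_univ b) -> Prop) :
  dP no_param P -> (forall e, P false e) -> forall e, P true e.
Proof.
move=> [phi [r H]] h e; apply/H.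
pose f n := if r n is inl k then k else 0%N.
have pE b (e' : nat -> two_univ b) : penv r e' = e' \o f.
  by apply/funext => n; rewrite /penv /f /=; case: (r n) => // -[].
rewrite pE -sat_fren; set psi := fren f phi.
have hU (e' : nat -> U) : sat e' psi.
  by have := proj1 (H false e') (h e'); rewrite pE => ?; apply/sat_fren.
have [x0 _] := ps_empty (zermelo_pairing_structure (std_zermelo N)).
have : sat (fun=> x0) (fclose (fsize psi) psi) by apply/sat_fclose => a; exact: hU.
rewrite (star_elementary _ (fun=> x0)) sat_fclose => /(_ e).
by apply: sat_ext_imp => n ->.
Qed.

Lemma int_pairing_structure : pairing_structure V.
Proof.
have [h1 h2 h3 h4] := zermelo_pairing_structure (std_zermelo N).
have x0 : V by have [x _] := cid h4; exact: (star x).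
split.
- pose P (b : bool) (e : nat -> two_univ b) :=
    forall x y : two_univ b, (forall z, z ∈ x <-> z ∈ y) -> x = y.
  by apply: (@transfer_valid P _ _ (fun=> x0)) => // ; repeat dp3.
- pose P (b : bool) (e : nat -> two_univ b) :=
    forall x y : two_univ b, exists w, is_upair w x y.
  by apply: (@transfer_valid P _ _ (fun=> x0)) => // ; repeat dp3.
- pose P (b : bool) (e : nat -> two_univ b) :=
    forall x y : two_univ b, exists z, forall w, w ∈ z <-> w ∈ x \/ w = y.
  by apply: (@transfer_valid P _ _ (fun=> x0)) => // ; repeat dp3.
- pose P (b : bool) (e : nat -> two_univ b) := exists x : two_univ b, is_empty x.
  by apply: (@transfer_valid P _ _ (fun=> x0)) => // ; repeat dp3.
Qed.

Let psV := int_pairing_structure.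

Lemma int_inductive : exists w : V, is_inductive w.
Proof.
pose P (b : bool) (e : nat -> two_univ b) := exists w : two_univ b, is_inductive w.
apply: (@transfer_valid P _ _ (fun=> zero psV)).
  by rewrite /P /is_inductive; repeat dp3.
rewrite /P => ?; have [w [[e he ew] hw]] := infinity (std_zermelo N).
have psU := zermelo_pairing_structure (std_zermelo N).
exists w; split=> [e' he'|x s /hw[s' hs' sw] hs].
  by rewrite (empty_uniq psU he' he).
by rewrite (succ_uniq psU hs hs').
Qed.

(** In [U] separation holds for the predicate given by any formula under any assignment. For a fixed
    formula this is a statement quantified over assignments, so it transfers, and the assignment in
    [V] may then carry nonstandard parameters. *)
Lemma int_separation (P : V -> Prop) : internal_property P ->
  forall x, exists y, forall z, z ∈ y <-> z ∈ x /\ P z.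
Proof.
move=> [phi [r H]] x.
(* [P] is evaluated at the constant assignment [z], so all free variables collapse to 0, and the
   parameters take the remaining places of [e]. *)
pose f n := if r n is inl _ then 0%N else n.+1.
pose e n := if r n is inr c then sval c tt else x.
have PE z : P z <-> sat (scons z e) (fren f phi).
  rewrite (H tt (fun=> z)) sat_fren.
  set e1 := penv _ _; set e2 := _ \o _; suff -> : e1 = e2 by [].
  by apply/funext => n; rewrite /e1 /e2 /penv /f /= /e; case E: (r n) => //=; rewrite E.
set psi := fren f phi.
pose Q (b : bool) (e : nat -> two_univ b) :=
  forall x, exists y, forall z, z ∈ y <-> z ∈ x /\ sat (scons z e) psi.
have : Q true e.
  apply: transfer_valid => [|e' y].
    rewrite /Q; repeat dp3.
    have hs : @dP _ two_univ no_param (fun b e => sat e psi) by exists psi, inl.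
    apply: dP_ext (dP_ren (scons 0%N (fun n => n.+3)) hs) => b e'.
    suff -> : (fun n => e' (scons 0%N (fun n => n.+3) n)) =
              scons (e' 0%N) (fun n => e' n.+3) by [].
    by apply/funext => -[].
  exact: (separation (std_zermelo N) (fun z => sat (scons z e') psi)).
by move=> /(_ x)[y hy]; exists y => z; rewrite hy PE.
Qed.

Lemma int_induction (P : V -> Prop) : internal_property P ->
  P (zero psV) -> (forall n, is_nat n -> P n -> P (succ psV n)) ->
  forall n, is_nat n -> P n.
Proof.
move=> hP P0 PS n hn; have [w hw] := int_inductive.
(* Separating by [is_nat z /\ P z] instead of [P z] gives the successor step its premise
   [is_nat n]. *)
have hQ : internal_property (fun z => is_nat z /\ P z).
  by rewrite /internal_property; repeat dp3.
have [W hW] := int_separation hQ w.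
suff /hn/hW[_ []//] : is_inductive W.
split=> [e /(is_emptyE psV) ->|x s /hW[xw [hx Px]] /(is_succE psV) ->].
  apply/hW; split; last by split=> //; apply: is_nat_zero.
  by apply: (proj1 hw); apply: zeroP.
apply/hW; split; last by split; [apply: is_nat_succ|apply: PS].
by apply: (proj2 hw x) => //; apply/(is_succE psV).
Qed.

End Transfer.

(** * Internal sums *)

Section Naturals.
Variable N : nonstandard_universe.
Local Notation V := (int_univ N).
Let psV := int_pairing_structure N.
Local Notation "0v" := (zero psV).
Local Notation sc := (succ psV).
Implicit Types (n i j f : V).

Lemma nat_mem n i : is_nat n -> i ∈ n -> is_nat i.
Proof.
move=> hn; move: n hn i; apply: int_induction.
- by rewrite /internal_property; repeat dp4.
- by move=> i /zeroP.
- by move=> n hn IH i /succP[/IH|->].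
Qed.

Lemma nat_trans n i j : is_nat n -> i ∈ n -> j ∈ i -> j ∈ n.
Proof.
move=> hn; move: n hn i j; apply: int_induction.
- by rewrite /internal_property; repeat dp4.
- by move=> i j /zeroP.
- move=> n hn IH i j /succP[/IH h|->] ?; apply/succP; left => //; exact: h.
Qed.

Lemma nat_irrefl n : is_nat n -> ~ n ∈ n.
Proof.
move: n; apply: int_induction.
- by rewrite /internal_property; repeat dp4.
- exact: zeroP.
- move=> n hn IH /succP[h|h]; apply: IH.
    by apply: (nat_trans hn h); apply/succP; right.
  by rewrite -{2}h; apply/succP; right.
Qed.

Lemma mem_succ n : n ∈ sc n.
Proof. by apply/succP; right. Qed.

Lemma succ_mem n i : is_nat n -> sc i ∈ n -> i ∈ n.
Proof. by move=> hn h; apply: (nat_trans hn h); apply: mem_succ. Qed.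

Lemma succ_zero i : sc i <> 0v.
Proof. by move=> h; apply: (@zeroP _ psV i); rewrite -h; apply: mem_succ. Qed.

Lemma nat_mem_neq n i : is_nat n -> i ∈ n -> sc i <> sc n.
Proof.
move=> hn hi h; have : n ∈ sc i by rewrite h; apply: mem_succ.
case/succP => [hni|E]; last by move: hi; rewrite -E; apply: nat_irrefl.
by apply: (nat_irrefl hn); apply: (nat_trans hn hi).
Qed.

Lemma succ_mem_succ n i : is_nat n -> i ∈ n -> sc i ∈ sc n.
Proof.
move=> hn; move: n hn i; apply: int_induction.
- by rewrite /internal_property; repeat dp4.
- by move=> i /zeroP.
- move=> n hn IH i /succP[/IH h|->]; last exact: mem_succ.
  by apply/succP; left.
Qed.

Lemma zero_mem_succ n : is_nat n -> 0v ∈ sc n.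
Proof.
move: n; apply: int_induction.
- by rewrite /internal_property; repeat dp4.
- exact: mem_succ.
- by move=> n hn h; apply/succP; left.
Qed.

(** All pairs over [a] are separated out of [f] before the new pair is adjoined, so [a] ends up with
    exactly one value. *)
Lemma app_update f a y : exists f',
  app psV f' a = y /\ forall x, x <> a -> app psV f' x = app psV f x.
Proof.
have hP : internal_property (fun z => ~ exists y : V, z = kpair psV a y).
  by rewrite /internal_property; repeat dp4.
have [f0 hf0] := int_separation hP f.
exists (adjoin psV f0 (kpair psV a y)); split=> [|x xa].
  apply: appE => [|y' /(pair_inE psV)/adjoinP[/hf0[_ []]|/kpair_inj[]//]].
    by apply/(pair_inE psV)/adjoinP; right.
  by exists y'.
have E y' : pair_in (adjoin psV f0 (kpair psV a y)) x y' <-> pair_in f x y'.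
  rewrite !(pair_inE psV) adjoinP hf0; split=> [[[]//|/kpair_inj[]//]|h].
  by left; split=> // -[? /kpair_inj[]].
apply: (congr1 (@xget {classic V} 0v)); apply/seteqP; split=> z [/E h1 h2]; split=> //.
  by move=> y' /E/h2.
by move=> y' /E/h2.
Qed.

(* The values of F need not lie in a common set known in advance, so the graph
   is built by internal induction and not by separation. *)
Lemma internal_seqP n (F : V -> V) :
  dT V (fun _ e => F (e 0%N)) -> is_nat n -> internal_seq n F.
Proof.
move=> dFF; move: n; apply: int_induction.
- rewrite /internal_property /internal_seq; repeat dp4.
- by exists 0v => i y; rewrite (pair_inE psV); split=> [/zeroP|[/zeroP]].
- move=> n hn [f hf]; exists (adjoin psV f (kpair psV n (F n))) => i y.
  rewrite (pair_inE psV) adjoinP -(pair_inE psV) hf; split.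
    by case=> [[h ->]|/kpair_inj[-> ->]]; split=> //; apply/succP; [left|right].
  by move=> [/succP[h|->] ->]; [left|right].
Qed.

Lemma internal_seq_app n (s : V -> V) : internal_seq n s ->
  exists f, forall i, i ∈ n -> app psV f i = s i.
Proof.
move=> [f hf]; exists f => i hi; apply: appE; first by apply/hf.
by move=> y' /hf[].
Qed.

End Naturals.

Section Sums.
Variables (N : nonstandard_universe) (G : internal_group (int_univ N)).
Local Notation V := (int_univ N).
Local Notation cG := (icoding G).
Let psV := int_pairing_structure N.
Local Notation "0v" := (zero psV).
Local Notation sc := (succ psV).
Implicit Types (i j f : V).

Definition decode (x : V) : G := xget 0 [set g | cG g = x].

Lemma code_decode g : decode (cG g) = g.
Proof.
rewrite /decode; case: xgetP => [z _ /(@code_inj _ _ cG)//|/(_ g)/= h].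
by case: h.
Qed.

Definition dG (t : (nat -> V) -> G) := dT V (fun _ e => cG (t e)).
Ltac toG := cbv beta; lazymatch goal with
  | |- dF _ (fun _ e => code (icoding _) (@?b e)) => change (dG b) end.

Definition dG1 (g : V -> G) := dG (fun e => g (e 0%N)).
Definition dG2 (g : V -> V -> G) := dG (fun e => g (e 0%N) (e 1%N)).
Definition dT1 (F : V -> V) := dT V (fun _ e => F (e 0%N)).
Definition dT2 (F : V -> V -> V) := dT V (fun _ e => F (e 0%N) (e 1%N)).
Definition dV2 (P : V -> V -> Prop) := dV V (fun _ e => P (e 0%N) (e 1%N)).

Lemma dT1_sub F t : dT1 F -> dT V t -> dT V (fun u e => F (t u e)).
Proof. exact: (@dF_sub1 _ _ _ (fun=> F)). Qed.

Lemma dT2_sub F s t : dT2 F -> dT V s -> dT V t ->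
  dT V (fun u e => F (s u e) (t u e)).
Proof. exact: (@dF_sub2 _ _ _ (fun=> F)). Qed.

Lemma internal_property_sub (P : V -> Prop) t : internal_property P -> dT V t -> dV V (fun u e => P (t u e)).
Proof. exact: (@dP_sub1 _ _ _ (fun=> P)). Qed.

Lemma dV2_sub P s t : dV2 P -> dT V s -> dT V t ->
  dV V (fun u e => P (s u e) (t u e)).
Proof. exact: (@dP_sub2 _ _ _ (fun=> P)). Qed.

Lemma dG1_sub g t : dG1 g -> dT V (fun=> t) -> dG (fun e => g (t e)).
Proof. exact: (@dF_sub1 _ _ _ (fun _ x => cG (g x))). Qed.

Lemma dG2_sub g s t : dG2 g -> dT V (fun=> s) -> dT V (fun=> t) ->
  dG (fun e => g (s e) (t e)).
Proof. exact: (@dF_sub2 _ _ _ (fun _ x y => cG (g x y))). Qed.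

Lemma dG_const g : dG (fun=> g).
Proof. exact: dT_const. Qed.

Lemma dG_ext s t : s =1 t -> dG s -> dG t.
Proof. by move=> /funext ->. Qed.

Lemma dP_eqG s t : dG s -> dG t -> dV V (fun _ e => s e = t e).
Proof.
move=> hs ht; apply: dP_ext (dP_eq hs ht) => _ e.
by split=> [/(@code_inj _ _ cG)//|->].
Qed.

Lemma dG_if (P : (nat -> V) -> Prop) s t : dV V (fun=> P) -> dG s -> dG t ->
  dG (fun e => if `[< P e >] then s e else t e).
Proof.
move=> hP hs ht; apply: dF_ext (dF_if hP hs ht) => _ e.
by case: asboolP.
Qed.

Lemma csetG x : x ∈ cset cG <-> exists g, cG g = x.
Proof. exact: csetP. Qed.

Lemma dG_decode t : dT V (fun=> t) -> dG (fun e => decode (t e)).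
Proof.
apply: (@dF_sub1 _ _ _ (fun _ x => cG (decode x))).
apply: (@dP_ext _ _ _ (fun _ e => (e 1%N ∈ cset cG /\ e 0%N = e 1%N) \/
  (~ e 1%N ∈ cset cG /\ e 0%N = cG 0))); last by repeat dp4.
move=> _ e; rewrite csetG.
have [[g hg]|h] := pselect (exists g, cG g = e 1%N).
  rewrite -hg code_decode; split=> [[[]//|[]]|->]; last by left; split=> //; exists g.
  by case; exists g.
have -> : decode (e 1%N) = 0.
  by rewrite /decode; case: xgetP => // g _ hg; case: h; exists g.
by split=> [[[]//|[]//]|->]; right.
Qed.

Lemma dG_add s t : dG s -> dG t -> dG (fun e => s e + t e).
Proof.
(* Passing through [decode] turns addition into an operation on all of [V], into which definable
   terms can be substituted. *)
move=> hs ht; apply: (@dF_ext _ _ _ (fun _ e =>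
    cG (decode (cG (s e)) + decode (cG (t e))))).
  by move=> _ e; rewrite !code_decode.
apply: (@dF_sub2 _ _ _ (fun _ x y => cG (decode x + decode y))) => //.
have [S hS] := iadd G.
apply: (@dP_ext _ _ _ (fun _ e => e 0%N ∈ cset cG /\
  pair_in S (kpair psV (cG (decode (e 1%N))) (cG (decode (e 2%N)))) (e 0%N))).
  move=> _ e; split=> [[/csetG[z <-] h]|->].
    suff -> : decode (e 1%N) + decode (e 2%N) = z by [].
    by apply/hS; exists (kpair psV (cG (decode (e 1%N))) (cG (decode (e 2%N))));
      split=> //; apply: kpairP.
  split; first by apply/csetG; exists (decode (e 1%N) + decode (e 2%N)).
  have [w [/(is_pairE psV) -> //]] := proj2 (hS (decode (e 1%N)) (decode (e 2%N)) _) erefl.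
by repeat dp4; toG; apply: dG_decode; repeat dp4.
Qed.

Lemma dG_opp s : dG s -> dG (fun e => - s e).
Proof.
(* [iadd] only makes addition internal; the negative is defined as the element whose sum with [s e]
   is 0. *)
move=> hs; have H : dV V (fun _ e => e 0%N ∈ cset cG /\
    cG (decode (e 0%N) + s (fun n => e n.+1)) = cG 0).
  repeat dp4; toG; apply: dG_add; first by apply: dG_decode; repeat dp4.
  exact: (dP_ren (fun n => if n is 0%N then 0%N else n.+1) hs).
refine (dP_ext _ H) => _ e; split=> [[/csetG[z <-]]|->].
  by rewrite code_decode => /(@code_inj _ _ cG)/eqP; rewrite addr_eq0 => /eqP ->.
by rewrite code_decode addNr; split=> //; apply/csetG; exists (- s (fun n => e n.+1)).
Qed.

Definition gapp f i : G := decode (app psV f i).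

Lemma dG_gapp s t : dT V (fun=> s) -> dT V (fun=> t) -> dG (fun e => gapp (s e) (t e)).
Proof. by move=> hs ht; apply: dG_decode; apply: dT_app. Qed.

Lemma gapp_update f a g : exists f',
  gapp f' a = g /\ forall x, x <> a -> gapp f' x = gapp f x.
Proof.
have [f' [h1 h2]] := app_update f a (cG g); exists f'.
by split=> [|x xa]; rewrite /gapp ?h1 ?code_decode ?h2.
Qed.

Definition psum f n (g : V -> G) :=
  gapp f 0v = 0 /\ forall i, i ∈ n -> gapp f (sc i) = gapp f i + g i.

(** Internal counterpart of [hsum]: the sequence of partial sums is an element [f] of [V] instead of
    a function of the metatheory, so a formula can quantify over it and sums stay definable in their
    parameters. *)
Definition gsum n (g : V -> G) : G :=
  xget 0 [set v | is_nat n /\ exists f, psum f n g /\ v = gapp f n].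

Lemma psum_uniq n f f' g : is_nat n -> psum f n g -> psum f' n g ->
  gapp f n = gapp f' n.
Proof.
move=> hn [h0 hS] [h0' hS'].
have : n ∈ sc n by exact: mem_succ.
suff H i : is_nat i -> i ∈ sc n -> gapp f i = gapp f' i by apply: H.
move: i; apply: int_induction.
- rewrite /internal_property; repeat dp4.
  by apply: dP_eqG; apply: dG_gapp; repeat dp4.
- by rewrite h0 h0'.
- move=> i hi IH hs.
  have hin : i ∈ n.
    by move/succP: hs => [/(succ_mem hn)//|<-]; apply: mem_succ.
  by rewrite hS // hS' // IH //; apply/succP; left.
Qed.

Lemma psum_ex n g : dG1 g -> is_nat n -> exists f, psum f n g.
Proof.
move=> dg; move: n; apply: int_induction.
- rewrite /internal_property /psum; repeat dp4.
    by apply: dP_eqG; [apply: dG_gapp|apply: dG_const]; repeat dp4.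
  apply: dP_eqG; first by apply: dG_gapp; repeat dp4.
  by apply: dG_add; [apply: dG_gapp|apply: dG1_sub]; repeat dp4.
- have [f [hf _]] := gapp_update 0v 0v 0; exists f.
  by split=> // i /zeroP.
- move=> n hn [f [f0 fS]].
  have [f' [h1 h2]] := gapp_update f (sc n) (gapp f n + g n); exists f'.
  have nn x : x ∈ n \/ x = n -> x <> sc n.
    move=> h E; move: (is_nat_succ psV hn) => /nat_irrefl; apply.
    by rewrite -{1}E; apply/succP.
  split; first by rewrite h2 //; apply/nesym; apply: succ_zero.
  move=> i /succP[hi|->].
    by rewrite h2 ?h2 ?fS //; [apply: nn; left|apply: nat_mem_neq].
  by rewrite h1 h2 //; apply: nn; right.
Qed.

Lemma gsumE n f g : is_nat n -> psum f n g -> gsum n g = gapp f n.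
Proof.
move=> hn hf; rewrite /gsum; case: xgetP => [v _ [_ [f' [hf' ->]]]|/(_ (gapp f n))].
  exact: psum_uniq hf' hf.
by case; split=> //; exists f.
Qed.

(** By [psum_uniq] any sequence of partial sums determines the same last term. The value is
    therefore that term or the default 0, and both cases are formulas; nested sums thus remain open
    to internal induction. *)
Lemma dG_gsum s (t : V -> (nat -> V) -> G) :
  dT V (fun=> s) -> dG (fun e => t (e 0%N) (fun n => e n.+1)) ->
  dG (fun e => gsum (s e) (fun i => t i e)).
Proof.
move=> hs ht.
pose Q (e : nat -> V) y := is_nat (s e) /\ exists f,
  psum f (s e) (t^~ e) /\ y = cG (gapp f (s e)).
apply: (@dP_ext _ _ _ (fun _ e => Q (fun n => e n.+1) (e 0%N) \/
   (~ (exists y, Q (fun n => e n.+1) y) /\ e 0%N = cG 0))).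
  move=> _ e; set e' := fun n => e n.+1.
  have [[hn [f hf]]|h] := pselect (is_nat (s e') /\ exists f, psum f (s e') (t^~ e')).
    rewrite (gsumE hn hf); split=> [[[_ [f' [hf' ->]]]|[[]]]|->].
    - by rewrite (psum_uniq hn hf hf').
    - by exists (cG (gapp f (s e'))); split=> //; exists f.
    - by left; split=> //; exists f.
  have -> : gsum (s e') (t^~ e') = 0.
    rewrite /gsum; case: xgetP => // v _ [hn [f [hf _]]].
    by case: h; split=> //; exists f.
  split=> [[[hn [f [hf _]]]|[]//]|->].
    by case: h; split=> //; exists f.
  by right; split=> // -[y [hn [f [hf _]]]]; case: h; split=> //; exists f.
have hQ : dV V (fun _ e => Q (fun n => e n.+1) (e 0%N)).
  have ss k : dT V (fun _ e => s (fun n => e (n + k)%N)).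
    exact: (dP_ren (fun n => if n is m.+1 then (m + k).+1 else 0%N) hs).
  have s1 : dT V (fun _ e => s (fun n => e n.+1)).
    by apply: dF_ext (ss 1%N) => _ e; congr s; apply/funext => n; rewrite addn1.
  have s2 : dT V (fun _ e => s (fun n => e n.+2)).
    by apply: dF_ext (ss 2%N) => _ e; congr s; apply/funext => n; rewrite addn2.
  have s3 : dT V (fun _ e => s (fun n => e n.+3)).
    by apply: dF_ext (ss 3%N) => _ e; congr s; apply/funext => n; rewrite addn3.
  rewrite /Q /psum; repeat dp4.
  - by apply: dP_eqG; [apply: dG_gapp|apply: dG_const]; repeat dp4.
  - apply: dP_eqG; first by apply: dG_gapp; repeat dp4.
    apply: dG_add; first by apply: dG_gapp; repeat dp4.
    exact: (dP_ren (fun n => match n with 0%N => 0%N | 1%N => 1%N | m.+2 => m.+4 end) ht).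
  - by toG; apply: dG_gapp; repeat dp4.
apply: dP_or => //; apply: dP_and; last by repeat dp4.
apply/dP_not/dP_ex.
exact: (dP_ren (fun n => if n is m.+1 then m.+2 else 0%N) hQ).
Qed.

Lemma gsum0 g : gsum 0v g = 0.
Proof.
have [f [hf _]] := gapp_update 0v 0v 0.
rewrite (@gsumE _ f) //; first exact: is_nat_zero.
by split=> // i /zeroP.
Qed.

Lemma gsumS n g : dG1 g -> is_nat n -> gsum (sc n) g = gsum n g + g n.
Proof.
move=> dg hn; have hn' := is_nat_succ psV hn.
have [f [f0 fS]] := psum_ex dg hn'.
rewrite (@gsumE _ f) // (@gsumE n f) //; last first.
  by split=> // i hi; apply: fS; apply/succP; left.
by rewrite fS //; apply: mem_succ.
Qed.

Lemma eq_gsum n g g' : (forall i, i ∈ n -> g i = g' i) -> gsum n g = gsum n g'.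
Proof.
move=> h; apply: (congr1 (@xget G 0)); apply/seteqP.
split=> v [hn [f [[h0 hf] ->]]]; split=> //; exists f; split=> //; split=> // i hi;
  by rewrite hf // h.
Qed.

(** A witness of [hsum] is required to be internal, so the set [F] that represents it serves as a
    sequence for [psum]. Conversely [gapp f] is definable, hence internal up to any natural
    number. *)
Lemma hsum_gsum n g : dG1 g -> is_nat n -> hsum n g = gsum n g.
Proof.
move=> dg hn; have [f pf] := psum_ex dg hn; rewrite (gsumE hn pf).
case: (pf) => f0 fS.
rewrite /hsum; case: xgetP => [v _ [m [S [hm [F hF] S0 SS ->]]]|/(_ (gapp f n))/=].
  have FS i : i ∈ m -> gapp F i = S i.
    move=> hi; rewrite /gapp -(code_decode (S i)); congr decode.
    by apply: appE; [apply/hF|move=> y' /hF[]].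
  have nm : n ∈ m by apply/hm; right.
  have sn i : i ∈ n -> sc i ∈ m.
    by move=> hi; apply/hm/succP; apply: succ_mem_succ.
  have zm : 0v ∈ m by apply/hm/succP; apply: zero_mem_succ.
  rewrite -FS //; apply: (@psum_uniq _ _ _ g) => //; split=> //.
    by rewrite FS // S0 //; apply: zeroP.
  move=> i hi; have im : i ∈ m by apply/hm; left.
  rewrite (FS _ (sn _ hi)) (FS _ im).
  by apply: SS => //; apply/(is_succE psV).
case; exists (sc n), (gapp f); split=> //.
- exact/(is_succE psV).
- apply: internal_seqP; last exact: is_nat_succ.
  by have : dG1 (gapp f) by apply: dG_gapp; repeat dp4.
- by move=> e /(is_emptyE psV) ->.
- by move=> i j hi /(is_succE psV) ->; apply: fS.
Qed.

End Sums.

(** * Formal sums of simplices *)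

Definition dS (N : nonstandard_universe) p (s : (nat -> int_univ N) -> simplex (int_univ N) p) :=
  forall m, dT (int_univ N) (fun _ e => s e m).
Definition dS1 (N : nonstandard_universe) p (s : int_univ N -> simplex (int_univ N) p) :=
  forall m, dT1 (N := N) (fun x => s x m).
(** A formula cannot take a tuple of the metatheory as argument; a map of simplices counts as
    definable when it preserves definable families. *)
Definition dmap (N : nonstandard_universe) p q
    (phi : simplex (int_univ N) p -> simplex (int_univ N) q) :=
  forall s : (nat -> int_univ N) -> simplex (int_univ N) p, dS s -> dS (phi \o s).
Definition dmap2 (N : nonstandard_universe) p q
    (phi : int_univ N -> simplex (int_univ N) p -> simplex (int_univ N) q) :=
  forall t (s : (nat -> int_univ N) -> simplex (int_univ N) p),
    dT (int_univ N) (fun=> t) -> dS s -> dS (fun e => phi (t e) (s e)).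

Section SimplexCode.
Variable N : nonstandard_universe.
Local Notation V := (int_univ N).
Let psV := int_pairing_structure N.

(** Iterated projections read every element of [V] as a simplex, and every simplex arises in this
    way. Quantifying over [T] in [V] thus replaces quantifying over simplices inside a formula. *)
Definition simplex_code p (T : V) : simplex V p :=
  fun k => fst_of psV (iter k (snd_of psV) T).

Lemma simplex_codeP p (a : simplex V p) : exists T, @simplex_code p T = a.
Proof.
suff H (l : nat) (f : nat -> V) : exists T, forall k, (k < l)%N ->
    fst_of psV (iter k (snd_of psV) T) = f k.
  have [T hT] := H p.+1 (fun k => a (inord k)); exists T.
  by apply/funext => k; rewrite /simplex_code hT ?inord_val.
elim: l f => [|l IH] f; first by exists (zero psV).
have [T hT] := IH (fun k => f k.+1); exists (kpair psV (f 0%N) T) => -[_|k hk] /=.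
  by rewrite fst_kpair.
by rewrite -iterS iterSr snd_kpair hT.
Qed.

Lemma dS_simplex_code p t : dT V (fun=> t) -> dS (fun e => @simplex_code p (t e)).
Proof.
move=> ht m; apply: dT_fst; elim: (m : nat) => [//|k IH].
exact: (@dT_snd _ _ (fun _ e => iter k (snd_of psV) (t e))) IH.
Qed.

End SimplexCode.

Lemma dP_eqS (N : nonstandard_universe) p
    (s t : (nat -> int_univ N) -> simplex (int_univ N) p) :
  dS s -> dS t -> dV (int_univ N) (fun _ e => s e = t e).
Proof.
move=> hs ht; have H : dV (int_univ N) (fun _ e => forall m, s e m = t e m).
  by apply: dP_fall => m; apply: dP_eq.
by refine (dP_ext _ H) => _ e; split=> [/funext//|->].
Qed.

Lemma dG_mulrz (N : nonstandard_universe) (G : internal_group (int_univ N))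
    (s : (nat -> int_univ N) -> G) (z : int) :
  dG s -> dG (fun e => s e *~ z).
Proof.
move=> hs; have hn n : dG (fun e => s e *+ n).
  elim: n => [|n IH]; first exact: dG_const.
  by apply: dG_ext (dG_add hs IH) => e; rewrite mulrS.
by case: z => n; [exact: hn|apply: dG_opp; exact: hn].
Qed.

Lemma dG_sum (N : nonstandard_universe) (G : internal_group (int_univ N))
    (B : finType) (s : B -> (nat -> int_univ N) -> G) :
  (forall b, dG (s b)) -> dG (fun e => \sum_b s b e).
Proof.
move=> hs; elim: (index_enum B) => [|b l IH].
  by apply: dG_ext (dG_const _) => e; rewrite big_nil.
by apply: dG_ext (dG_add (hs b) IH) => e; rewrite big_cons.
Qed.

Ltac dp5 := cbv beta; first [ assumption | lazymatch goal with
  | |- dG _ => match goal with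
    | H : dG1 ?g |- dG (fun e => ?g (@?t e)) => apply: (dG1_sub (t := t) H)
    | H : dG2 ?g |- dG (fun e => ?g (@?s e) (@?t e)) =>
        apply: (dG2_sub (s := s) (t := t) H)
    | H : forall b, _ |- dG (fun e => ?g ?b (@?s e) (@?t e)) =>
        apply: (dG2_sub (s := s) (t := t) (H b))
    | |- dG (fun e => gsum (@?s e) (@?t e)) =>
        let x := constr:(@dG_gsum _ _ s (fun i e => t e i)) in apply: x
    | |- dG (fun e => decode ?G (@?t e)) => let x := constr:(@dG_decode _ G t) in apply: x
    | |- dG (fun e => gapp ?G (@?s e) (@?t e)) => let x := constr:(@dG_gapp _ G s t) in apply: x
    | |- _ => first [apply: dG_const | apply: dG_if | apply: dG_add | apply: dG_opp
                    | apply: dG_mulrz | apply: dG_sum => ?]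
    end
  | |- dS _ => move=> ?
  | |- dF _ (fun _ e => code (icoding _) (@?b e)) => change (dG b)
  | |- dF _ (fun _ e => simplex_code (@?t e) ?m) =>
      refine (@dS_simplex_code _ _ t _ m)
  | |- dF _ _ => match goal with
    | H : dT1 ?F |- dF _ (fun _ e => ?F (@?t e)) =>
        apply: (dT1_sub (t := fun=> t) H)
    | H : dT2 ?F |- dF _ (fun _ e => ?F (@?s e) (@?t e)) =>
        apply: (dT2_sub (s := fun=> s) (t := fun=> t) H)
    | H : dS1 ?s |- dF _ (fun _ e => ?s (@?t e) ?m) =>
        apply: (dT1_sub (t := fun=> t) (H m))
    | H : dmap ?phi |- dF _ (fun _ e => ?phi (@?s e) ?m) => refine (H s _ m)
    | H : dmap2 ?phi |- dF _ (fun _ e => ?phi (@?t e) (@?s e) ?m) =>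
        refine (H t s _ _ m)
    | |- _ => first [apply: dF_if | dp4]
    end
  | |- dP _ _ => match goal with
    | H : internal_property ?P |- dP _ (fun _ e => ?P (@?t e)) =>
        apply: (internal_property_sub (t := fun=> t) H)
    | H : dV2 ?P |- dP _ (fun _ e => ?P (@?s e) (@?t e)) =>
        apply: (dV2_sub (s := fun=> s) (t := fun=> t) H)
    | |- _ => first [apply: dP_eqG | apply: dP_eqS | dp4 | apply: dP_fall => ?]
    end
  end ].

Ltac definable :=
  rewrite /internal_property /dG1 /dG2 /dT1 /dT2 /dV2 /comp; repeat dp5.

Section FormalSums.
Variables (N : nonstandard_universe) (G : internal_group (int_univ N)).
Local Notation V := (int_univ N).
Let psV := int_pairing_structure N.
Local Notation "0v" := (zero psV).
Local Notation sc := (succ psV).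
Implicit Types (g : V -> G) (p q : nat).

Lemma gsum_add n g g' : dG1 g -> dG1 g' -> is_nat n ->
  gsum n (fun i => g i + g' i) = gsum n g + gsum n g'.
Proof.
move=> dg dg'; move: n; apply: int_induction.
- by definable.
- by rewrite !gsum0 addr0.
- move=> n hn IH; rewrite !gsumS ?IH //; last by definable.
  by rewrite addrACA.
Qed.

Lemma gsum_opp n g : dG1 g -> is_nat n -> gsum n (fun i => - g i) = - gsum n g.
Proof.
move=> dg; move: n; apply: int_induction.
- by definable.
- by rewrite !gsum0 oppr0.
- move=> n hn IH; rewrite !gsumS ?IH //; last by definable.
  by rewrite opprD.
Qed.

Lemma gsum_eq0 n g : is_nat n -> (forall i, i ∈ n -> g i = 0) -> gsum n g = 0.
Proof.
move=> hn hg; rewrite (eq_gsum (g' := fun=> 0)) //.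
move: n hn {hg}; apply: int_induction.
- by definable.
- by rewrite gsum0.
- by move=> n hn IH; rewrite gsumS ?IH ?addr0 //; definable.
Qed.

Lemma gsum_telescope n g : dG1 g -> is_nat n ->
  gsum n (fun i => g (sc i) - g i) = g n - g 0v.
Proof.
move=> dg; move: n; apply: int_induction.
- by definable.
- by rewrite !gsum0 subrr.
- move=> n hn IH; rewrite gsumS //; first by rewrite IH addrC addrA subrK.
  by definable.
Qed.

Lemma gsum_mulrz n g (z : int) : dG1 g -> is_nat n ->
  gsum n (fun i => g i *~ z) = gsum n g *~ z.
Proof.
move=> dg; move: n; apply: int_induction.
- by definable.
- by rewrite !gsum0 mul0rz.
- by move=> n hn IH; rewrite !gsumS ?IH ?mulrzDl //; definable.
Qed.

Lemma gsum_sum n (B : finType) (g : B -> V -> G) : (forall b, dG1 (g b)) ->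
  is_nat n -> gsum n (fun i => \sum_b g b i) = \sum_b gsum n (g b).
Proof.
move=> dg hn; elim: (index_enum B) => [|b l IH].
  by rewrite big_nil; apply: gsum_eq0 => // i _; rewrite big_nil.
rewrite big_cons -IH -gsum_add //.
  by apply: eq_gsum => i _; rewrite big_cons.
rewrite /dG1; elim: l {IH} => [|a l IH].
  by apply: dG_ext (dG_const _) => e; rewrite big_nil.
by apply: dG_ext (dG_add (dg a) IH) => e; rewrite big_cons.
Qed.

(* If the coefficients add up to 0 over each class of E, then they do so over
   every E-saturated set D: induct on k over the part of D that E relates to
   some index below k. *)
Lemma gsum_classes n g (D : V -> Prop) (E : V -> V -> Prop) :
  is_nat n -> dG1 g -> internal_property D -> dV2 E ->
  (forall i, E i i) -> (forall i k, E i k -> E k i) ->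
  (forall i k l, E i k -> E k l -> E i l) -> (forall i k, E i k -> D i -> D k) ->
  (forall k, k ∈ n -> gsum n (fun i => if `[< E i k >] then g i else 0) = 0) ->
  gsum n (fun i => if `[< D i >] then g i else 0) = 0.
Proof.
move=> hn dg dD dE Er Es Et ED hE.
pose T k := gsum n (fun i =>
  if `[< D i /\ exists l, l ∈ k /\ E i l >] then g i else 0).
have TP : forall k, is_nat k -> (forall l, l ∈ k -> l ∈ n) -> T k = 0; last first.
  rewrite -[RHS](TP n hn) //; apply: eq_gsum => i hi; congr (if _ then _ else _).
  by apply/asbool_equiv_eq; split=> [h|[]//]; split=> //; exists i.
apply: (@int_induction N (fun k => (forall l, l ∈ k -> l ∈ n) -> T k = 0)); rewrite /T.
- by definable.
- move=> _; apply: (gsum_eq0 hn) => x _.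
  by case: asboolP => // -[_ [l [/zeroP]]].
- move=> k hk IH hsub.
  have {}IH := IH (fun l hl => hsub l (proj2 (succP psV k l) (or_introl hl))).
  have kn : k ∈ n by apply: hsub; apply: mem_succ.
  (* The new index [k] matters only if it lies in [D] and its class has not been met below [k]; then
     exactly the class of [k] is added, and [hE] makes its contribution vanish. *)
  have [[Dk nk]|hDk] := pselect (D k /\ ~ exists l, l ∈ k /\ E k l); last first.
    rewrite -[RHS]IH; apply: eq_gsum => i hi; congr (if _ then _ else _).
    apply/asbool_equiv_eq; split=> -[Di [l [hl Eil]]]; split=> //; last first.
      by exists l; split=> //; apply/succP; left.
    move/succP: hl => [hl|lk]; first by exists l.
    subst l; have [[l [lk Ekl]]|no] := pselect (exists l, l ∈ k /\ E k l).
      by exists l; split=> //; apply: Et Eil Ekl.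
    by case: hDk; split=> //; apply: ED Eil Di.
  transitivity (T k + gsum n (fun i => if `[< E i k >] then g i else 0)); last first.
    by rewrite (hE k kn) addr0.
  rewrite /T -gsum_add //; [|by definable..].
  apply: eq_gsum => i hi.
  have [Eik|nEik] := pselect (E i k).
    have -> : `[< D i /\ exists l, l ∈ k /\ E i l >] = false.
      apply: asboolF => -[_ [l [lk Eil]]]; apply: nk; exists l; split=> //.
      by apply: Et Eil; apply: Es.
    rewrite (asboolT Eik) add0r asboolT //; split; first by apply: ED Dk; apply: Es.
    by exists k; split=> //; apply: mem_succ.
  rewrite (asboolF nEik) addr0; congr (if _ then _ else _).
  apply/asbool_equiv_eq; split=> -[Di [l [hl Eil]]]; split=> //; exists l; split=> //.
    by move/succP: hl => [//|lk]; case: nEik; rewrite -lk.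
  by apply/succP; left.
Qed.

(** Same chain as the [formal_sum] of the [elem], with the coefficient selected by a case
    distinction, which is directly a formula. *)
Definition fsum p (n : V) g (sigma : V -> simplex V p) : chain G p :=
  fun t => gsum n (fun i => if `[< sigma i = t >] then g i else 0).

(** The sequences are definable functions on all of [V], not only internal up to [n];
    [hyperfinite_rep] and [rep_hyperfinite] pass between the two notions. *)
Definition is_rep p (n : V) g (sigma : V -> simplex V p) :=
  [/\ is_nat n, dG1 g & dS1 sigma].

(** [Q] is an arbitrary predicate of the metatheory, because being a microsimplex is external. *)
Definition mchain p (Q : simplex V p -> Prop) : set (chain G p) :=
  [set c | exists n g sigma,
    [/\ is_rep n g sigma, forall i, i ∈ n -> Q (sigma i) & c = fsum n g sigma]].

Lemma eq_fsum p n g g' (sigma sigma' : V -> simplex V p) :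
  (forall i, i ∈ n -> g i = g' i) -> (forall i, i ∈ n -> sigma i = sigma' i) ->
  fsum n g sigma = fsum n g' sigma'.
Proof.
move=> hg hs; apply/funext => t; apply: eq_gsum => i hi.
by rewrite hg // hs.
Qed.

End FormalSums.

(** * Homomorphisms of chain groups induced by maps of simplices *)

Section Push.
Variables (N : nonstandard_universe) (G : internal_group (int_univ N)).
Local Notation V := (int_univ N).
Let psV := int_pairing_structure N.
Local Notation "0v" := (zero psV).
Local Notation sc := (succ psV).
Implicit Types (g : V -> G) (p q r : nat).

(* The internal induction needs the identity uniformly in T, which in the
   applications codes the simplex at which a chain is evaluated. *)
Lemma append (B : finType) (F : B -> V -> V -> G) (y : V -> V) (n f m : V) :
  (forall b, dG2 (F b)) -> dT1 y -> is_nat n -> is_nat m ->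
  exists n' f', is_nat n' /\
    (forall k, k ∈ n' -> (exists l, l ∈ n /\ app psV f' k = app psV f l) \/
                         (exists i, i ∈ m /\ app psV f' k = y i)) /\
    forall b T, gsum n' (fun k => F b T (app psV f' k)) =
      gsum n (fun k => F b T (app psV f k)) + gsum m (fun i => F b T (y i)).
Proof.
move=> dF dy hn; move: m; apply: int_induction.
- by definable.
- exists n, f; split=> //; split=> [k hk|b T]; first by left; exists k.
  by rewrite gsum0 addr0.
- move=> m hm [n' [f' [hn' [hr hs]]]].
  have [f'' [f1 f2]] := app_update f' n' (y m).
  have old k : k ∈ n' -> app psV f'' k = app psV f' k.
    by move=> hk; apply: f2 => E; move: hk; rewrite E; apply: nat_irrefl.
  exists (sc n'), f''; split; first exact: is_nat_succ.
  split=> [k /succP[hk|->]|b T].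
  + rewrite old //; have [?|[i [hi ->]]] := hr k hk; first by left.
    by right; exists i; split=> //; apply/succP; left.
  + by right; exists m; split=> //; apply: mem_succ.
  + rewrite !gsumS // 1?f1 ?addrA; [|by definable..].
    congr (_ + _); rewrite -hs; apply: eq_gsum => k hk; by rewrite old.
Qed.

(** A double sum becomes a single sum along one internal sequence of index pairs. The origin of each
    pair is part of the conclusion because it is internal and survives the induction; external
    properties of the terms are recovered from it afterwards. The finite type [B] lets one sequence
    serve several summands. *)
Lemma flatten (B : finType) (F : B -> V -> V -> G) (n m : V) :
  (forall b, dG2 (F b)) -> is_nat n -> is_nat m ->
  exists n' f', is_nat n' /\
    (forall k, k ∈ n' -> exists i j, i ∈ n /\ j ∈ m /\
       app psV f' k = kpair psV i j) /\
    forall b T, gsum n' (fun k => F b T (app psV f' k)) =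
      gsum m (fun j => gsum n (fun i => F b T (kpair psV i j))).
Proof.
move=> dF hn; move: m; apply: int_induction.
- by definable.
- exists 0v, 0v; split; first exact: is_nat_zero.
  by split=> [k /zeroP|b T]; rewrite ?gsum0.
- move=> m hm [n' [f' [hn' [hr hs]]]].
  have dk : dT1 (fun i => kpair psV i m) by definable.
  have [n2 [f2 [hn2 [hr2 hs2]]]] := append f' dF dk hn' hn.
  exists n2, f2; split=> //; split=> [k /hr2[[l [/hr[i [j [hi [hj ->]]]] ->]]|[i [hi ->]]]|b T].
  + by exists i, j; do !split=> //; apply/succP; left.
  + by exists i, m; do !split=> //; apply: mem_succ.
  + by rewrite hs2 hs gsumS //; definable.
Qed.

Lemma concat p r (phi : simplex V p -> simplex V r) n g sigma n' g' sigma' :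
  dmap phi -> is_rep n g sigma -> is_rep n' g' sigma' ->
  exists m h tau, [/\ is_rep (p := p) m h tau,
    forall k, k ∈ m -> (exists i, i ∈ n /\ tau k = sigma i) \/
                       (exists i, i ∈ n' /\ tau k = sigma' i),
    fsum m h tau = fsum n g sigma + fsum n' g' sigma'
  & fsum m h (fun i => phi (tau i)) =
    fsum n g (fun i => phi (sigma i)) + fsum n' g' (fun i => phi (sigma' i))].
Proof.
move=> dphi [hn dg dsig] [hn' dg' dsig'].
(* The term i of the first (second) sequence is coded by the pair (i, 0)
   (respectively, (i, 1)). *)
pose h w := if `[< snd_of psV w = 0v >] then g (fst_of psV w) else g' (fst_of psV w).
pose tau w : simplex V p := fun k => if `[< snd_of psV w = 0v >]
  then sigma (fst_of psV w) k else sigma' (fst_of psV w) k.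
have dh : dG1 h by rewrite /h; definable.
have dtau : dS1 tau by move=> k; rewrite /tau; definable.
(* The index [b] stands for the chain itself or its image under [phi]; both identities must hold for
   the same sequence [tau]. *)
pose F (b : bool) T w := if b
  then (if `[< tau w = simplex_code T >] then h w else 0)
  else (if `[< phi (tau w) = simplex_code T >] then h w else 0).
have dF b : dG2 (F b) by case: b; rewrite /F; definable.
have d0 : dT1 (fun i => kpair psV i 0v) by definable.
have d1 : dT1 (fun i => kpair psV i (sc 0v)) by definable.
have h0 i : h (kpair psV i 0v) = g i by rewrite /h snd_kpair fst_kpair asboolT.
have nz : sc 0v <> 0v by apply: succ_zero.
have h1 i : h (kpair psV i (sc 0v)) = g' i by rewrite /h snd_kpair fst_kpair asboolF.
have t0 i : tau (kpair psV i 0v) = sigma i.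
  by apply/funext => k; rewrite /tau snd_kpair fst_kpair asboolT.
have t1 i : tau (kpair psV i (sc 0v)) = sigma' i.
  by apply/funext => k; rewrite /tau snd_kpair fst_kpair asboolF.
have hz := is_nat_zero psV.
have [m1 [f1 [hm1 [r1 s1]]]] := append 0v dF d0 hz hn.
have [m2 [f2 [hm2 [r2 s2]]]] := append f1 dF d1 hm1 hn'.
exists m2, (fun k => h (app psV f2 k)), (fun k => tau (app psV f2 k)).
have S b T : gsum m2 (fun k => F b T (app psV f2 k)) =
  gsum n (fun i => F b T (kpair psV i 0v)) + gsum n' (fun i => F b T (kpair psV i (sc 0v))).
  by rewrite s2 s1 gsum0 add0r.
split.
- by split=> //; [|move=> k]; definable.
- move=> k /r2[[l [/r1[[? [/zeroP//]]|[i [hi ->]]] ->]]|[i [hi ->]]].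
    by left; exists i; rewrite t0.
  by right; exists i; rewrite t1.
- apply/funext => t; have [T <-] := simplex_codeP t.
  rewrite [LHS](S true T) /fsum; congr (_ + _); apply: eq_gsum => i _; rewrite /F.
    by rewrite t0 h0.
  by rewrite t1 h1.
- apply/funext => t; have [T <-] := simplex_codeP t.
  rewrite [LHS](S false T) /fsum; congr (_ + _); apply: eq_gsum => i _; rewrite /F.
    by rewrite t0 h0.
  by rewrite t1 h1.
Qed.

(** Group the indices by [sigma i]. The coefficients of each group add up to the coefficient of the
    chain at that simplex, which is 0, and the indices with [phi (sigma i) = t] form a union of
    groups. *)
Lemma fsum_map_eq0 p r (phi : simplex V p -> simplex V r) n g sigma :
  dmap phi -> is_rep n g sigma -> fsum n g sigma = 0 ->
  fsum n g (fun i => phi (sigma i)) = 0.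
Proof.
move=> dphi [hn dg dsig] h0; apply/funext => t.
apply: (@gsum_classes _ _ _ _ (fun i => phi (sigma i) = t)
  (fun i k => sigma i = sigma k)) => //; try by definable.
- by move=> i k l -> ->.
- by move=> i k <-.
- by move=> k _; move/(congr1 (fun c => c (sigma k))): h0.
Qed.

Lemma is_rep_opp p n g (sigma : V -> simplex V p) : is_rep n g sigma ->
  is_rep n (fun i => - g i) sigma /\
  fsum n (fun i => - g i) sigma = - fsum n g sigma.
Proof.
move=> [hn dg ds]; split; first by split=> //; definable.
apply/funext => t; rewrite -[RHS]/(- fsum n g sigma t) /fsum.
rewrite -gsum_opp //; last by definable.
by apply: eq_gsum => i _; case: ifP => // _; rewrite oppr0.
Qed.

Lemma is_rep_map p r (phi : simplex V p -> simplex V r) n g sigma :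
  dmap phi -> is_rep n g sigma -> is_rep n g (fun i => phi (sigma i)).
Proof. by move=> dphi [hn dg ds]; split=> // m; definable. Qed.

(** The concatenation of the first representation with the opposite of the second represents 0, to
    which [fsum_map_eq0] applies. *)
Lemma fsum_map_uniq p r (phi : simplex V p -> simplex V r) n g sigma n' g' sigma' :
  dmap phi -> is_rep n g sigma -> is_rep n' g' sigma' ->
  fsum n g sigma = fsum n' g' sigma' ->
  fsum n g (fun i => phi (sigma i)) = fsum n' g' (fun i => phi (sigma' i)).
Proof.
move=> dphi h h' E; have [ho Eo] := is_rep_opp h'.
have [_ Eo'] := is_rep_opp (is_rep_map dphi h').
have [m [k [tau [ht _ E1 E2]]]] := concat dphi h ho.
have := fsum_map_eq0 dphi ht; rewrite E1 Eo E subrr => /(_ erefl).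
by rewrite E2 Eo' => /eqP; rewrite subr_eq0 => /eqP.
Qed.

Definition push p r (phi : simplex V p -> simplex V r) (c : chain G p) : chain G r :=
  xget 0 [set c' | exists n g sigma, [/\ is_rep n g sigma,
     c = fsum n g sigma & c' = fsum n g (fun i => phi (sigma i))]].

Lemma pushE p r (phi : simplex V p -> simplex V r) n g sigma :
  dmap phi -> is_rep n g sigma ->
  push phi (fsum n g sigma) = fsum n g (fun i => phi (sigma i)).
Proof.
move=> dphi h; rewrite /push; case: xgetP => [c' _ [n' [g' [s' [h' E ->]]]]|].
  by apply: fsum_map_uniq => //; rewrite E.
by move/(_ (fsum n g (fun i => phi (sigma i)))); case; exists n, g, sigma.
Qed.

Definition hyperchain p (c : chain G p) :=
  exists n g sigma, is_rep n g sigma /\ c = fsum n g sigma.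

Lemma mchain_hyper p (Q : simplex V p -> Prop) c : mchain Q c -> hyperchain c.
Proof. by move=> [n [g [s [h _ ->]]]]; exists n, g, s. Qed.

Lemma dmap_id p : dmap (fun a : simplex V p => a).
Proof. by []. Qed.

Lemma mchain0 p (Q : simplex V p -> Prop) : mchain (G := G) Q 0.
Proof.
exists 0v, (fun=> 0), (fun _ _ => 0v); split.
- by split=> [||m]; [exact: is_nat_zero|definable|definable].
- by move=> i /zeroP.
- by apply/funext => t; rewrite /fsum gsum0.
Qed.

Lemma mchain_none p (c : chain G p) : mchain (fun=> False) c -> c = 0.
Proof.
move=> [n [g [s [[hn _ _] h ->]]]]; apply/funext => t.
by apply: gsum_eq0 => // i /h.
Qed.

Lemma mchain_sub p (Q : simplex V p -> Prop) (x y : chain G p) :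
  mchain Q x -> mchain Q y -> mchain Q (x - y).
Proof.
move=> [n [g [s [h hQ ->]]]] [n' [g' [s' [h' hQ' ->]]]].
have [ho <-] := is_rep_opp h'.
have [m [k [tau [ht hr E _]]]] := concat (@dmap_id p) h ho.
exists m, k, tau; split=> // i /hr[[l [hl ->]]|[l [hl ->]]]; [exact: hQ|exact: hQ'].
Qed.

Lemma mchain_opp p (Q : simplex V p -> Prop) (x : chain G p) : mchain Q x -> mchain Q (- x).
Proof. by rewrite -sub0r; apply: mchain_sub; apply: mchain0. Qed.

Lemma mchain_add p (Q : simplex V p -> Prop) (x y : chain G p) :
  mchain Q x -> mchain Q y -> mchain Q (x + y).
Proof. by move=> hx hy; rewrite -[y]opprK; apply/mchain_sub/mchain_opp. Qed.

Lemma mchain_mulrz p (Q : simplex V p -> Prop) (x : chain G p) (z : int) :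
  mchain Q x -> mchain Q (x *~ z).
Proof.
move=> hx; have hn n : mchain Q (x *+ n).
  by elim: n => [|n IH]; [exact: mchain0|rewrite mulrS; apply: mchain_add].
by case: z => n; [exact: hn|apply/mchain_opp/hn].
Qed.

Lemma mchain_sum p (Q : simplex V p -> Prop) (B : finType) (x : B -> chain G p) :
  (forall b, mchain Q (x b)) -> mchain Q (\sum_b x b).
Proof.
move=> hx; elim/big_ind: _ => [|y z|b _]; [exact: mchain0|exact: mchain_add|exact: hx].
Qed.

Lemma push_mchain p r (phi : simplex V p -> simplex V r) Q Q' c :
  dmap phi -> (forall a, Q a -> Q' (phi a)) -> mchain Q c -> mchain Q' (push phi c).
Proof.
move=> dphi hphi [n [g [s [h hQ ->]]]]; rewrite pushE //.
exists n, g, (fun i => phi (s i)); split=> //; first exact: is_rep_map.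
by move=> i /hQ/hphi.
Qed.

Lemma push_sub p r (phi : simplex V p -> simplex V r) x y :
  dmap phi -> hyperchain x -> hyperchain y ->
  push phi (x - y) = push phi x - push phi y.
Proof.
move=> dphi [n [g [s [h ->]]]] [n' [g' [s' [h' ->]]]].
have [ho Eo] := is_rep_opp h'.
have [m [k [tau [ht hr E E']]]] := concat dphi h ho.
rewrite -Eo -E !pushE // E'; congr (_ + _).
by have [_ ->] := is_rep_opp (is_rep_map dphi h').
Qed.

Lemma push_comp p q r (phi : simplex V p -> simplex V q)
    (psi : simplex V q -> simplex V r) c :
  dmap phi -> dmap psi -> hyperchain c ->
  push psi (push phi c) = push (fun a => psi (phi a)) c.
Proof.
move=> dphi dpsi [n [g [s [h ->]]]].
have dpp : dmap (fun a => psi (phi a)) by move=> t ht m; definable.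
by rewrite (pushE dphi h) (pushE dpp h) (pushE dpsi (is_rep_map dphi h)).
Qed.

Definition hpush p r (m : V) (phi : V -> simplex V p -> simplex V r)
    (c : chain G p) : chain G r :=
  fun t => gsum m (fun j => push (phi j) c t).

Lemma dmap2_dmap p r (phi : V -> simplex V p -> simplex V r) j :
  dmap2 phi -> dmap (phi j).
Proof. by move=> h s hs; apply: h => //; apply: dT_const. Qed.

Lemma hpushE p r m (phi : V -> simplex V p -> simplex V r) n g sigma :
  dmap2 phi -> is_rep n g sigma ->
  hpush m phi (fsum n g sigma) =
  fun t => gsum m (fun j => fsum n g (fun i => phi j (sigma i)) t).
Proof.
move=> dphi h; apply/funext => t; apply: eq_gsum => j _.
by rewrite pushE //; apply: dmap2_dmap.
Qed.

(** The terms of all the pushed copies are indexed by pairs [(i, j)] and flattened into one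
    representation. Its simplices are of the form [phi j (sigma i)], whence [hpush_mchain]; that the
    same sequence also represents the image under [psi] gives [push_hpush]. *)
Lemma hpush_rep p q r m (phi : V -> simplex V p -> simplex V q)
    (psi : simplex V q -> simplex V r) n g sigma :
  dmap2 phi -> dmap psi -> is_nat m -> is_rep n g sigma ->
  exists l h tau, [/\ is_rep l h tau,
    forall k, k ∈ l -> exists i j, [/\ i ∈ n, j ∈ m & tau k = phi j (sigma i)],
    hpush m phi (fsum n g sigma) = fsum l h tau
  & hpush m (fun j a => psi (phi j a)) (fsum n g sigma) =
    fsum l h (fun i => psi (tau i))].
Proof.
move=> dphi dpsi hm hr; have [hn dg dsig] := hr.
pose h w := g (fst_of psV w).
pose tau w := phi (snd_of psV w) (sigma (fst_of psV w)).
have dh : dG1 h by rewrite /h; definable.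
have dtau : dS1 tau by move=> k; rewrite /tau; definable.
pose F (b : bool) T w := if b
  then (if `[< tau w = simplex_code T >] then h w else 0)
  else (if `[< psi (tau w) = simplex_code T >] then h w else 0).
have dF b : dG2 (F b) by case: b; rewrite /F; definable.
have [l [f [hl [rl sl]]]] := flatten dF hn hm.
exists l, (fun k => h (app psV f k)), (fun k => tau (app psV f k)); split.
- by split=> //; [|move=> k]; definable.
- move=> k /rl[i [j [hi [hj ->]]]]; exists i, j; split=> //.
  by rewrite /tau fst_kpair snd_kpair.
- rewrite hpushE //; apply/funext => t; have [T <-] := simplex_codeP t.
  rewrite [RHS](sl true T); apply: eq_gsum => j _; apply: eq_gsum => i _.
  by rewrite /F /tau /h fst_kpair snd_kpair.
- have dpp : dmap2 (fun j a => psi (phi j a)) by move=> s t hs ht k; definable.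
  rewrite hpushE //; apply/funext => t; have [T <-] := simplex_codeP t.
  rewrite [RHS](sl false T); apply: eq_gsum => j _; apply: eq_gsum => i _.
  by rewrite /F /tau /h fst_kpair snd_kpair.
Qed.

Lemma hpush_mchain p r m (phi : V -> simplex V p -> simplex V r) Q Q' c :
  dmap2 phi -> is_nat m -> (forall j a, j ∈ m -> Q a -> Q' (phi j a)) ->
  mchain Q c -> mchain Q' (hpush m phi c).
Proof.
move=> dphi hm hphi [n [g [s [h hQ ->]]]].
have [l [k [tau [hk hr -> _]]]] := hpush_rep dphi (@dmap_id r) hm h.
exists l, k, tau; split=> // x /hr[i [j [hi hj ->]]].
by apply: hphi => //; apply: hQ.
Qed.

Lemma push_hpush p q r m (phi : V -> simplex V p -> simplex V q)
    (psi : simplex V q -> simplex V r) c :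
  dmap2 phi -> dmap psi -> is_nat m -> hyperchain c ->
  push psi (hpush m phi c) = hpush m (fun j a => psi (phi j a)) c.
Proof.
move=> dphi dpsi hm [n [g [s [h ->]]]].
have [l [k [tau [hk hr -> ->]]]] := hpush_rep dphi dpsi hm h.
by rewrite pushE.
Qed.

Lemma hpush_push p q r m (phi : V -> simplex V q -> simplex V r)
    (psi : simplex V p -> simplex V q) c :
  dmap2 phi -> dmap psi -> hyperchain c ->
  hpush m phi (push psi c) = hpush m (fun j a => phi j (psi a)) c.
Proof.
move=> dphi dpsi hc; apply/funext => t; apply: eq_gsum => j _.
by rewrite push_comp //; apply: dmap2_dmap.
Qed.

Lemma hpush_sub p r m (phi : V -> simplex V p -> simplex V r) x y :
  dmap2 phi -> is_nat m -> hyperchain x -> hyperchain y ->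
  hpush m phi (x - y) = hpush m phi x - hpush m phi y.
Proof.
move=> dphi hm [n [g [s [h ->]]]] [n' [g' [s' [h' ->]]]].
apply/funext => t.
rewrite -[RHS]/(hpush m phi (fsum n g s) t - hpush m phi (fsum n' g' s') t).
rewrite !hpushE //; case: (h) (h') => hn dg ds [hn' dg' ds'].
rewrite -gsum_opp // -?gsum_add //; try by rewrite /fsum; definable.
apply: eq_gsum => j _; rewrite push_sub //; first by rewrite !pushE //; apply: dmap2_dmap.
- exact: dmap2_dmap.
- by exists n, g, s.
- by exists n', g', s'.
Qed.

(** * Hyperlinear extension *)

Lemma eq_hsum (n : V) g g' : (forall i, i ∈ n -> g i = g' i) -> hsum n g = hsum n g'.
Proof.
move=> h; apply: (congr1 (@xget G 0)); apply/seteqP.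
split=> v [m [S [h1 h2 h3 h4 h5]]]; exists m, S; split=> // i j hi hj;
  by rewrite (h4 i j) // h.
Qed.

(** Applying the internal set that represents a sequence is a definable function on all of [V], and
    it agrees with the sequence below [n]. *)
Lemma hyperfinite_rep p n g (sigma : V -> simplex V p) : hyperfinite_seq n g sigma ->
  exists g' sigma', is_rep n g' sigma' /\
    forall i, i ∈ n -> g i = g' i /\ sigma i = sigma' i.
Proof.
move=> [hn /internal_seq_app[f hf] hs].
have /choice[F hF] k := internal_seq_app (hs k).
exists (fun i => decode G (app psV f i)), (fun i k => app psV (F k) i); split.
  by split=> //; [|move=> k]; definable.
move=> i hi; split; first by rewrite hf // code_decode.
by apply/funext => k; rewrite hF.
Qed.

Lemma rep_hyperfinite p n g (sigma : V -> simplex V p) :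
  is_rep n g sigma -> hyperfinite_seq n g sigma.
Proof.
move=> [hn dg ds]; split=> // [|k]; apply: internal_seqP => //; exact: ds.
Qed.

Lemma chain_mulrzE p (c : chain G p) (z : int) t : (c *~ z) t = c t *~ z.
Proof.
have hn n : (c *+ n) t = c t *+ n.
  by elim: n => [//|n IH]; rewrite !mulrS -IH.
by case: z => n; [exact: hn|congr (- _); exact: hn].
Qed.

(** Bridge from the integral coefficients in [hyperlinear] to [fsum]: a finite combination with
    standard integers commutes with the hyperfinite sum. *)
Lemma formal_sum_comb p r (B : finType) (phi : B -> simplex V p -> simplex V r)
    (z : B -> int) n g sigma :
  (forall b, dmap (phi b)) -> is_rep n g sigma ->
  formal_sum n g (fun i t => \sum_b z b * elem (phi b (sigma i)) t) =
  \sum_b fsum n g (fun i => phi b (sigma i)) *~ z b.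
Proof.
move=> dphi [hn dg ds]; apply/funext => t.
have E i : g i *~ (\sum_b z b * elem (phi b (sigma i)) t) =
    \sum_b (if `[< phi b (sigma i) = t >] then g i else 0) *~ z b.
  rewrite mulrz_sumr; apply: eq_bigr => b _; rewrite /elem.
  have -> : `[< t = phi b (sigma i) >] = `[< phi b (sigma i) = t >].
    by apply/asbool_equiv_eq; split.
  by case: ifP => _; rewrite ?mulr1 ?mulr0 ?mul0rz.
rewrite /formal_sum (eq_hsum (g' := fun i => \sum_b
   (if `[< phi b (sigma i) = t >] then g i else 0) *~ z b)) //.
have db b : dG1 (fun i => (if `[< phi b (sigma i) = t >] then g i else 0) *~ z b).
  by have hb := dphi b; definable.
rewrite hsum_gsum //; last by apply: dG_sum.
rewrite gsum_sum // fct_sumE; apply: eq_bigr => b _.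
rewrite gsum_mulrz //; last by have hb := dphi b; definable.
by rewrite chain_mulrzE.
Qed.

End Push.

(** * Homological algebra *)

Section Complexes.
Implicit Types (Z W : zmodType).

Lemma subr_interchange Z (a b c d : Z) : a - b - (c - d) = (a - c) - (b - d).
Proof. by rewrite !opprB addrACA [RHS]addrACA [- b + _]addrC. Qed.

Lemma subgroup_opp Z (S : set Z) x : is_subgroup S -> S x -> S (- x).
Proof. by move=> [S0 SB] Sx; rewrite -sub0r; apply: SB. Qed.

Lemma subgroup_add Z (S : set Z) x y : is_subgroup S -> S x -> S y -> S (x + y).
Proof.
by move=> hS Sx Sy; rewrite -[y]opprK; apply: (proj2 hS) => //; apply: subgroup_opp.
Qed.

Lemma is_hom_add_den Z W (S S0 : set Z) (T T0 : set W) F x y :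
  is_subgroup T0 -> is_hom S S0 T T0 F -> S x -> S y ->
  T0 (F x) -> T0 (F y) -> T0 (F (x + y)).
Proof.
move=> hT [_ _ hF] Sx Sy Tx Ty; rewrite -(subrK (F x + F y) (F (x + y))).
by apply: subgroup_add => //; [apply: hF|apply: subgroup_add].
Qed.

Lemma is_hom_sub Z W (S S0 : set Z) (T T0 : set W) F x y :
  is_subgroup S -> is_subgroup T0 -> is_hom S S0 T T0 F -> S x -> S y ->
  T0 (F (x - y) - (F x - F y)).
Proof.
move=> hS hT [_ _ hF] Sx Sy.
have := subgroup_opp hT (hF (x - y) y (proj2 hS _ _ Sx Sy) Sy).
by rewrite subrK opprB -addrA -[F y - F x]opprB.
Qed.

Lemma bounding_sub (C : complex) p : is_complex C -> forall x y,
  bounding C p x -> bounding C p y -> bounding C p (x - y).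
Proof.
move=> [hs [hb _]] x y [nx [u nu du]] [ny [v nv dv]].
have [snp sdp _] := hs p; have [snq _ _] := hs p.+1.
split; first exact: (proj2 snp).
exists (u - v); first exact: (proj2 snq).
have := is_hom_sub snq sdp (hb p) nu nv.
move/(subgroup_opp sdp)/(subgroup_add sdp (proj2 sdp _ _ du dv)).
by rewrite [- (bd C (u - v) - _)]opprB subr_interchange addrA subrK.
Qed.

Lemma cycles_num (C : complex) p z : cycles C p z -> num C p z.
Proof. by case: p z => [|p] z //= []. Qed.

(** [homology_map] takes the union over all representatives of a class, so each of them has to be
    known to be a cycle. *)
Lemma cycles_coset (C : complex) p z z' : is_complex C ->
  cycles C p z -> coset (bounding C p) z z' -> cycles C p z'.
Proof.
move=> hC hz [nb [y ny dy]]; have [hs [hb hbb]] := hC.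
have [snp sdp dn] := hs p.
have nz := cycles_num hz.
have nz' : num C p z' by rewrite -(subrK z z'); apply: subgroup_add.
case: p z z' hz nb y ny dy snp sdp dn nz nz' => [//|p] z z' [_ dz] nb y ny dy snp sdp dn nz nz'.
split=> //; have [_ sd _] := hs p; rewrite -(subrK z z').
apply: (is_hom_add_den sd (hb p)) => //.
have [hb1 _ _] := hb p.+1; have [_ hb2 _] := hb p.
(* [z' - z] is the sum of an element of [den] and of [bd C y]; [bd] maps the first into [den]
   because it is a homomorphism of quotients, the second because [bd] squares to 0. *)
rewrite -(subrK (bd C y) (z' - z)); apply: (is_hom_add_den sd (hb p)).
- exact: dn.
- exact: hb1.
- exact: hb2.
- exact: hbb.
Qed.

Lemma homotopic_bounding (C D : complex) (F H : forall p, amb C p -> amb D p) p z :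
  is_complex C -> is_complex D -> is_chain_map F -> is_chain_map H ->
  chain_homotopic F H -> cycles C p z -> bounding D p (H p z - F p z).
Proof.
move=> hC [hs _] [hF _] [hH _] [P [hP h0 hS]] hz.
have nz := cycles_num hz.
have [sn sd _] := hs p.
have [F1 _ _] := hF p; have [H1 _ _] := hH p; have [P1 P2 _] := hP p.
split; first by apply: (proj2 sn); [apply: H1|apply: F1].
exists (P p z); first exact: P1.
case: p z hz nz sn sd F1 H1 P1 P2 => [|p] z hz nz sn sd F1 H1 P1 P2.
  by rewrite -opprB; apply: subgroup_opp => //; apply: h0.
have [_ P2' _] := hP p.
(* For a cycle, [bd C z] lies in [den], hence so does [P p (bd C z)], and this term drops out of the
   homotopy identity. *)
have := proj2 sd _ _ (P2' _ (proj2 hz)) (hS p z nz).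
by rewrite opprB addrCA opprD [P p _ + _]addrCA subrr addr0.
Qed.

Lemma homotopic_homology (C D : complex) (F H : forall p, amb C p -> amb D p) :
  is_complex C -> is_complex D -> is_chain_map F -> is_chain_map H ->
  chain_homotopic F H ->
  forall p xi, homology C p xi -> homology_map F xi = homology_map H xi.
Proof.
move=> hC hD hF hH hFH p xi [z hz <-].
have B z' : coset (bounding C p) z z' -> bounding D p (H p z' - F p z').
  by move=> /(cycles_coset hC hz); apply: homotopic_bounding.
have B0 : bounding D p 0.
  have [h [_ _]] := hD; have [[n0 _] [d0 _] _] := h p.
  have [[n1 _] [d1 _] _] := h p.+1; split=> //; exists 0 => //.
  have [_ [hb _]] := hD; have [_ hb2 _] := hb p.
  by rewrite sub0r; apply: subgroup_opp; [have [_ ? _] := h p|exact: hb2].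
apply/seteqP; split=> y [z' hz' hy]; exists z' => //; rewrite /coset /=.
  rewrite -(subrK (F p z') y) -addrA -[F p z' - H p z']opprB.
  by apply: bounding_sub => //; apply: B.
have := bounding_sub hD B0 (B z' hz'); rewrite sub0r => hB.
rewrite -(subrK (H p z') y) -addrA -[H p z' - _]opprK.
by apply: bounding_sub.
Qed.

End Complexes.

(** * Alternating sums *)

Section AlternatingSums.
Variable W : zmodType.
Implicit Types (D E : nat -> nat -> W) (B : nat -> W).
Local Notation s n := ((-1) ^+ n : int).

Lemma sumz_cancel (x : W) n : x *~ s n + x *~ s n.+1 = 0.
Proof. by rewrite -mulrzDr exprS mulN1r subrr. Qed.

(** Here [D i j] is the [j]-th face of the [i]-th face. In the induction the new row [i = n.+1]
    cancels the new column [j = n] termwise, by the simplicial identity. *)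
Lemma alternating_faces D n :
  (forall i j, (i <= n)%N -> (j < i)%N -> D i j = D j i.-1) ->
  \sum_(i < n.+1) \sum_(j < n) D i j *~ s (i + j) = 0.
Proof.
elim: n => [|n IH] hD.
  by apply: big1 => i _; rewrite big_ord0.
rewrite big_ord_recr /=.
under eq_bigr => i _ do rewrite big_ord_recr /=.
rewrite big_split /= IH; last by move=> i j hi; apply: hD; apply: leqW.
rewrite add0r -big_split /=; apply: big1 => i _.
by rewrite (hD n.+1 i) //= addSn addnC sumz_cancel.
Qed.

(** The prism formula in any abelian group: [D l i] is the [l]-th face of the [i]-th prism, [E l i]
    the [i]-th prism of the [l]-th face, [B i] the face shared by the prisms [i.-1] and [i]. Faces
    off the two diagonals cancel against the prisms of faces; the diagonals contribute
    [B i - B i.+1], which telescopes. *)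
Lemma prism_sum D E B n :
  (forall l i, (i < n)%N -> (l < i)%N -> D l i = E l i.-1) ->
  (forall l i, (l <= n)%N -> (i.+1 < l)%N -> D l i = E l.-1 i) ->
  (forall i, (i < n)%N -> D i i = B i) ->
  (forall i, (i < n)%N -> D i.+1 i = B i.+1) ->
  \sum_(l < n.+1) \sum_(i < n) D l i *~ s (l + i) +
    \sum_(l < n) \sum_(i < n.-1) E l i *~ s (l + i) = B 0%N - B n.
Proof.
elim: n => [|n IH] h1 h2 h3 h4.
  by rewrite subrr big_ord0 addr0 big1 // => i _; rewrite big_ord0.
have {}IH := IH (fun l i hi => h1 l i (leqW hi)) (fun l i hi => h2 l i (leqW hi))
  (fun i hi => h3 i (leqW hi)) (fun i hi => h4 i (leqW hi)).
rewrite big_ord_recr /=.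
under eq_bigr => i _ do rewrite big_ord_recr /=.
rewrite big_split /= [X in _ + X + _ + _]big_ord_recr /= h3 //.
rewrite [X in _ + X + _]big_ord_recr /= h4 //.
under [X in _ + (X + _) + _ + _]eq_bigr => l _ do rewrite h1 //.
under [X in _ + _ + (X + _) + _]eq_bigr => l _ do rewrite h2 ?ltnS //=.
have -> : \sum_(l < n.+1) \sum_(i < n) E l i *~ s (l + i) =
    \sum_(l < n) \sum_(i < n.-1) E l i *~ s (l + i) -
    \sum_(l < n) E l n.-1 *~ s (l + n) - \sum_(i < n) E n i *~ s (n.+1 + i).
  rewrite big_ord_recr /= -!sumrN; congr (_ + _); last first.
    by apply: eq_bigr => i _; rewrite addSn exprS mulN1r mulrNz opprK.
  (* At [n = 0] there is no last column [i = n.-1] to split off, but then all sums over [n] are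
     empty. *)
  case: n {IH h1 h2 h3 h4} => [|n]; first by rewrite !big_ord0 addr0.
  rewrite -big_split /=; apply: eq_bigr => l _; rewrite big_ord_recr /=.
  by rewrite addnS exprS mulN1r mulrNz opprK.
have e1 : s (n + n) = 1 by rewrite -signr_odd oddD addbb.
have e2 : s (n.+1 + n) = -1 by rewrite addSn exprS e1 mulr1.
rewrite e1 e2 mulrN1z mulr1z.
have rearrange (a b c d e f : W) :
    a + (b + c) + (d - e) + (f - b - d) = a + f + c - e.
  by rewrite [LHS](AC (1*2*2*3) (1*6*3*5*(2*7)*(4*8))) /= !subrr !addr0.
by rewrite rearrange IH subrK.
Qed.

End AlternatingSums.

(** * Prisms *)

Section Prisms.
Variables (N : nonstandard_universe) (G : internal_group (int_univ N)).
Local Notation V := (int_univ N).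
Implicit Types (p l i : nat).

(* Faces and prism maps indexed by nat; out-of-range indices are junk. *)
Definition nface p l (a : simplex V p.+1) : simplex V p :=
  fun k => a (inord (bump l k)).

Definition prism p (u v : V -> V) i (a : simplex V p) : simplex V p.+1 :=
  fun k => if (k <= i)%N then u (a (inord k)) else v (a (inord k.-1)).

(** [prism u v i a] is [(u a_0, ..., u a_i, v a_i, ..., v a_p)]; omitting either copy of the vertex
    [i] leaves a staircase. Index 0 yields [v \o a], index [p.+1] yields [u \o a]. *)
Definition staircase p (u v : V -> V) i (a : simplex V p) : simplex V p :=
  fun k => if (k < i)%N then u (a k) else v (a k).

Lemma faceE p (j : 'I_p.+2) : @face V p j = @nface p j.
Proof.
apply/funext => a; apply/funext => k; rewrite /face /nface.
congr a; apply: val_inj; have hk := ltn_ord k.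
by rewrite /= inordK // /bump; lia.
Qed.

Lemma nface_nface p i j (a : simplex V p.+2) : (i <= p.+2)%N -> (j < i)%N ->
  nface j (nface i a) = nface i.-1 (nface j a).
Proof.
move=> hi hj; apply/funext => k; rewrite /nface.
have hk := ltn_ord k.
rewrite !inordK; try by rewrite /bump; lia.
by congr (a (inord _)); rewrite /bump; lia.
Qed.

Lemma nface_prism_lt p u v i l (a : simplex V p.+1) :
  (i < p.+2)%N -> (l < i)%N ->
  nface l (prism u v i a) = prism u v i.-1 (nface l a).
Proof.
move=> hi hl; apply/funext => k; rewrite /nface /prism.
have hk := ltn_ord k.
have e : nat_of_ord (inord (bump l k) : 'I_p.+3) = bump l k
  by rewrite inordK // /bump; lia.
rewrite e.
have -> : (bump l k <= i)%N = (k <= i.-1)%N by rewrite /bump; lia.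
case: leqP => h.
  by rewrite inordK //; lia.
rewrite inordK; last by lia.
by congr (v (a (inord _))); rewrite /bump; lia.
Qed.

Lemma nface_prism_gt p u v i l (a : simplex V p.+1) :
  (l <= p.+2)%N -> (i.+1 < l)%N ->
  nface l (prism u v i a) = prism u v i (nface l.-1 a).
Proof.
move=> hl hi; apply/funext => k; rewrite /nface /prism.
have hk := ltn_ord k.
have e : nat_of_ord (inord (bump l k) : 'I_p.+3) = bump l k
  by rewrite inordK // /bump; lia.
rewrite e.
have -> : (bump l k <= i)%N = (k <= i)%N by rewrite /bump; lia.
case: leqP => h; (rewrite inordK; last by lia).
  by congr (u (a (inord _))); rewrite /bump; lia.
by congr (v (a (inord _))); rewrite /bump; lia.
Qed.

Lemma nface_prism_diag p u v i (a : simplex V p) : (i < p.+1)%N ->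
  nface i (prism u v i a) = staircase u v i a.
Proof.
move=> hi; apply/funext => k; rewrite /nface /prism /staircase.
have hk := ltn_ord k.
have e : nat_of_ord (inord (bump i k) : 'I_p.+2) = bump i k
  by rewrite inordK // /bump; lia.
rewrite e.
have -> : (bump i k <= i)%N = (k < i)%N by rewrite /bump; lia.
by case: ltnP => h; [congr (u (a _))|congr (v (a _))];
  apply: val_inj; rewrite /= inordK /bump; lia.
Qed.

Lemma nface_prism_subdiag p u v i (a : simplex V p) : (i < p.+1)%N ->
  nface i.+1 (prism u v i a) = staircase u v i.+1 a.
Proof.
move=> hi; apply/funext => k; rewrite /nface /prism /staircase.
have hk := ltn_ord k.
have e : nat_of_ord (inord (bump i.+1 k) : 'I_p.+2) = bump i.+1 k
  by rewrite inordK // /bump; lia.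
rewrite e.
have -> : (bump i.+1 k <= i)%N = (k < i.+1)%N by rewrite /bump; lia.
by case: ltnP => h; [congr (u (a _))|congr (v (a _))];
  apply: val_inj; rewrite /= inordK /bump; lia.
Qed.

Lemma dmap_nface p l : dmap (@nface p l).
Proof. by move=> t ht k; apply: ht. Qed.

End Prisms.

(** * The prism homotopy *)

Section PrismOperator.
Variables (N : nonstandard_universe) (G : internal_group (int_univ N)).
Local Notation V := (int_univ N).
Let psV := int_pairing_structure N.
Local Notation "0v" := (zero psV).
Local Notation sc := (succ psV).
Local Notation s n := ((-1) ^+ n : int).
Implicit Types (p q l : nat).

Lemma hyperchainP p (c : chain G p) : hyperchain c <-> mchain (fun=> True) c.
Proof.
split=> [[n [g [t [h ->]]]]|]; last exact: mchain_hyper.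
by exists n, g, t.
Qed.

Section Additive.
Variables (p q : nat) (T : chain G p -> chain G q).
Hypothesis T_sub : forall x y, hyperchain x -> hyperchain y -> T (x - y) = T x - T y.

Let T0 : T 0 = 0.
Proof.
have h0 : hyperchain (0 : chain G p) by apply/hyperchainP/mchain0.
by have := T_sub h0 h0; rewrite !subrr.
Qed.

Lemma hyper_additiveN x : hyperchain x -> T (- x) = - T x.
Proof.
move=> hx; rewrite -sub0r T_sub ?T0 ?sub0r //.
by apply/hyperchainP/mchain0.
Qed.

Lemma hyper_additiveD x y : hyperchain x -> hyperchain y -> T (x + y) = T x + T y.
Proof.
move=> hx hy; rewrite -[y]opprK T_sub //; last first.
  by apply/hyperchainP/mchain_opp/hyperchainP.
by rewrite (hyper_additiveN hy) !opprK.
Qed.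

Lemma hyper_additive_comb (B : finType) (x : B -> chain G p) (z : B -> int) :
  (forall b, hyperchain (x b)) ->
  T (\sum_b x b *~ z b) = \sum_b T (x b) *~ z b.
Proof.
move=> hx; have hz b k : hyperchain (x b *~ k).
  by apply/hyperchainP/mchain_mulrz/hyperchainP.
have Tz b k : T (x b *~ k) = T (x b) *~ k.
  have hn n : T (x b *+ n) = T (x b) *+ n.
    elim: n => [|n IH]; first by rewrite !mulr0n.
    by rewrite !mulrS hyper_additiveD ?IH //; exact: (hz b n).
  case: k => n; first exact: hn.
  by rewrite !NegzE !mulrNz hyper_additiveN; [congr (- _); exact: hn|exact: (hz b n.+1)].
suff [_ ->] : hyperchain (\sum_b x b *~ z b) /\
   T (\sum_b x b *~ z b) = \sum_b T (x b *~ z b).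
  by apply: eq_bigr => b _; apply: Tz.
elim: (index_enum B) => [|b r [h IH]].
  by rewrite !big_nil; split=> //; apply/hyperchainP/mchain0.
rewrite !big_cons; split; last by rewrite hyper_additiveD ?IH.
by apply/hyperchainP; apply: mchain_add; apply/hyperchainP.
Qed.

End Additive.

Lemma hyper_push p q (phi : simplex V p -> simplex V q) (c : chain G p) :
  dmap phi -> hyperchain c -> hyperchain (push phi c).
Proof. by move=> d /hyperchainP h; apply/hyperchainP; apply: push_mchain h. Qed.

Lemma hyper_hpush p q m (phi : V -> simplex V p -> simplex V q) (c : chain G p) :
  dmap2 phi -> is_nat m -> hyperchain c -> hyperchain (hpush m phi c).
Proof. by move=> d hm /hyperchainP h; apply/hyperchainP; apply: hpush_mchain h. Qed.

Lemma formal_fsum p n g (sigma : V -> simplex V p) : is_rep n g sigma ->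
  formal_sum n g (fun i => elem (sigma i)) = fsum (G := G) n g sigma.
Proof.
move=> hr.
have := @formal_sum_comb _ G p p 'I_1 (fun _ a => a) (fun=> 1) n g sigma (fun=> @dmap_id N p) hr.
rewrite big_ord1 mulr1z => <-; apply/funext => t; apply: eq_hsum => i _.
by rewrite big_ord1 mul1r.
Qed.

(** Replacing an internal sequence by a definable one does not change the formal sums, and [push]
    does not depend on the representation; so every candidate for the [xget] in [hyperlinear] is the
    same chain. *)
Lemma hyperlinear_comb p q (B : finType) (phi : B -> simplex V p -> simplex V q)
    (z : B -> int) (c : chain G p) :
  (forall b, dmap (phi b)) -> hyperchain c ->
  hyperlinear (fun a t => \sum_b z b * elem (phi b a) t) c =
  \sum_b push (phi b) c *~ z b.
Proof.
move=> dphi hc.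
have H n g sigma : is_rep n g sigma -> c = fsum n g sigma ->
    formal_sum n g (fun i t => \sum_b z b * elem (phi b (sigma i)) t) =
    \sum_b push (phi b) c *~ z b.
  move=> hr ->; rewrite formal_sum_comb //.
  by apply: eq_bigr => b _; rewrite pushE.
have eq_formal r n g g' (w w' : V -> simplex V r -> int) :
    (forall i, i ∈ n -> g i = g' i /\ w i = w' i) ->
    formal_sum (G := G) n g w = formal_sum n g' w'.
  by move=> h; apply/funext => t; apply: eq_hsum => i /h[-> ->].
rewrite /hyperlinear; case: xgetP => [c' _ [n [g [sigma [h E ->]]]]|].
  have [g' [sigma' [hr hE]]] := hyperfinite_rep h.
  rewrite -(H n g' sigma') //.
    by apply: eq_formal => i /hE[-> ->].
  rewrite E -formal_fsum //.
  by apply: eq_formal => i /hE[-> ->].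
case: hc => n [g [sigma [h E]]].
move/(_ (formal_sum n g (fun i t => \sum_b z b * elem (phi b (sigma i)) t))); case.
by exists n, g, sigma; split=> //; [exact: rep_hyperfinite|rewrite formal_fsum].
Qed.

Lemma hyperlinear_elem p q (phi : simplex V p -> simplex V q) (c : chain G p) :
  dmap phi -> hyperchain c -> hyperlinear (fun a => elem (phi a)) c = push phi c.
Proof.
move=> dphi hc; have := @hyperlinear_comb _ _ 'I_1 (fun=> phi) (fun=> 1) c.
rewrite big_ord1 mulr1z => <- //; congr (hyperlinear _ c).
by apply/funext => a; apply/funext => t; rewrite big_ord1 mul1r.
Qed.

Lemma microchain_mchainE p (Q : simplex V p -> Prop) :
  [set c : chain G p | exists n g sigma, [/\ hyperfinite_seq n g sigma,
     forall i, i ∈ n -> Q (sigma i)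
   & c = formal_sum n g (fun i => elem (sigma i))]] = mchain Q.
Proof.
apply/seteqP; split=> c [n [g [sigma [h hQ ->]]]].
  have [g' [sigma' [hr hE]]] := hyperfinite_rep h.
  exists n, g', sigma'; split=> // [i hi|].
    by have [_ <-] := hE i hi; apply: hQ.
  rewrite -formal_fsum //; apply/funext => t; apply: eq_hsum => i /hE[-> ->] //.
exists n, g, sigma; split=> //; first exact: rep_hyperfinite.
by rewrite formal_fsum.
Qed.

Definition bdry p (c : chain G p.+1) : chain G p :=
  \sum_(l < p.+2) push (@nface N p l) c *~ s l.

Lemma boundaryE p (c : chain G p.+1) : hyperchain c -> boundary c = bdry c.
Proof.
move=> hc; rewrite /boundary /bdry hyperlinear_comb //; last first.
  by move=> b; rewrite faceE; apply: dmap_nface.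
by apply: eq_bigr => l _; rewrite faceE.
Qed.

Lemma bdry_sub p (x y : chain G p.+1) : hyperchain x -> hyperchain y ->
  bdry (x - y) = bdry x - bdry y.
Proof.
move=> hx hy; rewrite /bdry -sumrB; apply: eq_bigr => l _.
by rewrite push_sub ?mulrzBl //; apply: dmap_nface.
Qed.

Lemma push_bdry p q (phi : simplex V p -> simplex V q) (c : chain G p.+1) :
  dmap phi -> hyperchain c ->
  push phi (bdry c) = \sum_(l < p.+2) push (fun a => phi (nface l a)) c *~ s l.
Proof.
move=> dphi hc; rewrite /bdry hyper_additive_comb.
- by apply: eq_bigr => l _; rewrite push_comp //; apply: dmap_nface.
- by move=> x y; apply: push_sub.
- by move=> l; apply: hyper_push => //; apply: dmap_nface.
Qed.

Lemma bdry_bdry p (c : chain G p.+2) : hyperchain c -> bdry (bdry c) = 0.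
Proof.
move=> hc; rewrite [bdry (bdry c)]/bdry.
pose D i j := push (fun a : simplex V p.+2 => nface j (nface i a)) c.
have hD i j : (i <= p.+2)%N -> (j < i)%N -> D i j = D j i.-1.
  move=> hi hj; congr (push _ c); apply/funext => a; exact: nface_nface.
rewrite -[RHS](alternating_faces hD) exchange_big /=; apply: eq_bigr => j _.
rewrite push_bdry //; last exact: dmap_nface.
rewrite mulrz_suml; apply: eq_bigr => i _.
by rewrite /D -mulrzA exprD.
Qed.

Lemma push_map_bdry p (u : V -> V) (c : chain G p.+1) : dT1 u -> hyperchain c ->
  bdry (push (fun a => u \o a) c) = push (fun a => u \o a) (bdry c).
Proof.
move=> du hc.
have dm r : dmap (fun a : simplex V r => u \o a).
  by move=> t ht k; apply: (dT1_sub du (ht k)).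
rewrite push_bdry //; apply: eq_bigr => l _; rewrite push_comp //.
exact: dmap_nface.
Qed.

Section Prism.
Variables (m : V) (eta : V -> V -> V).
Hypotheses (hm : is_nat m) (deta : dT2 eta).

Definition prism_map p i (j : V) : simplex V p -> simplex V p.+1 :=
  prism (eta j) (eta (sc j)) i.

Lemma dmap2_prism p i : dmap2 (@prism_map p i).
Proof.
move=> t a ht ha k; rewrite /prism_map /prism /=; case: (k <= i)%N.
  exact: (dT2_sub deta ht (ha _)).
by apply: (dT2_sub deta _ (ha (inord k.-1))); apply: dT_succ.
Qed.

Definition prism_op p (c : chain G p) : chain G p.+1 :=
  \sum_(i < p.+1) hpush m (@prism_map p i) c *~ s i.

Lemma hpush_telescope p (c : chain G p) : hyperchain c ->
  hpush m (fun j a => eta (sc j) \o a) c - hpush m (fun j a => eta j \o a) c =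
  push (fun a => eta m \o a) c - push (fun a => eta 0v \o a) c.
Proof.
move=> [n [g [sigma [hr ->]]]]; case: (hr) => hn dg ds.
have de j : dT1 (eta j) by definable.
have dm j : dmap (fun a : simplex V p => eta j \o a).
  by move=> t ht k; apply: (dT1_sub (de j) (ht k)).
have d2 : dmap2 (fun j (a : simplex V p) => eta j \o a).
  by move=> t a ht ha k; definable; apply: ha.
have d2' : dmap2 (fun j (a : simplex V p) => eta (sc j) \o a).
  by move=> t a ht ha k; definable; apply: ha.
rewrite !hpushE // !pushE //; apply/funext => t.
(* The telescoping takes place in [G], one coefficient at a time: [F j] is the coefficient at [t] of
   the image under [eta j]. *)
pose F j := fsum n g (fun i => eta j \o sigma i) t.
have dF : dG1 F by rewrite /F /fsum; definable.
transitivity (F m - F 0v); last by [].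
rewrite -gsum_telescope // gsum_add //; try by definable.
by rewrite gsum_opp.
Qed.

Lemma prism_op_sub p (x y : chain G p) : hyperchain x -> hyperchain y ->
  prism_op (x - y) = prism_op x - prism_op y.
Proof.
move=> hx hy; rewrite /prism_op -sumrB; apply: eq_bigr => l _.
by rewrite hpush_sub ?mulrzBl //; apply: dmap2_prism.
Qed.

Lemma bdry_prism_op p (c : chain G p) : hyperchain c ->
  bdry (prism_op c) = \sum_(l < p.+2) \sum_(i < p.+1)
    hpush m (fun j a => nface l (prism_map i j a)) c *~ s (l + i).
Proof.
move=> hc; rewrite /bdry; apply: eq_bigr => l _; rewrite hyper_additive_comb.
- rewrite mulrz_suml; apply: eq_bigr => i _.
  rewrite push_hpush //; [|exact: dmap2_prism|exact: dmap_nface].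
  by rewrite -mulrzA exprD mulrC.
- by move=> x y; apply: push_sub; apply: dmap_nface.
- by move=> i; apply: hyper_hpush => //; apply: dmap2_prism.
Qed.

Lemma prism_op_bdry p (c : chain G p.+1) : hyperchain c ->
  prism_op (bdry c) = \sum_(l < p.+2) \sum_(i < p.+1)
    hpush m (fun j a => prism_map i j (nface l a)) c *~ s (l + i).
Proof.
move=> hc; rewrite exchange_big /=; apply: eq_bigr => i _.
rewrite /bdry hyper_additive_comb.
- rewrite mulrz_suml; apply: eq_bigr => l _.
  rewrite hpush_push //; [|exact: dmap2_prism|exact: dmap_nface].
  by rewrite -mulrzA exprD.
- by move=> x y; apply: hpush_sub => //; apply: dmap2_prism.
- by move=> l; apply: hyper_push => //; apply: dmap_nface.
Qed.

Let stairs p (c : chain G p) i :=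
  hpush m (fun j => @staircase N p (eta j) (eta (sc j)) i) c.

(** The prisms telescope twice. Within a step [j] the staircases [0] and [p.+1] survive, being the
    images under [eta (sc j)] and [eta j]; summed over [j < m], only the images under [eta m] and
    [eta 0v] remain. *)
Let stairs_ends p (c : chain G p) : hyperchain c ->
  stairs c 0%N - stairs c p.+1 =
  push (fun a => eta m \o a) c - push (fun a => eta 0v \o a) c.
Proof.
move=> hc; rewrite -hpush_telescope // /stairs; congr (hpush m _ c - hpush m _ c).
by apply/funext => j; apply/funext => a; apply/funext => k; rewrite /staircase ltn_ord.
Qed.

Lemma prism_homotopy0 (c : chain G 0) : hyperchain c ->
  bdry (prism_op c) =
  push (fun a => eta m \o a) c - push (fun a => eta 0v \o a) c.
Proof.
move=> hc; rewrite bdry_prism_op // -stairs_ends //.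
pose D l i := hpush m (fun j a => @nface N _ l (@prism_map 0 i j a)) c.
(* In degree 0 there are no prisms of faces: for [n = 1] the sum over [E] is empty, and any [E] will
   do. *)
have H := @prism_sum _ D (fun _ _ => 0) (stairs c) 1.
rewrite -H; rewrite ?big_ord0 ?addr0 //.
- by rewrite [X in _ + X]big1 ?addr0 // => i _; rewrite big_ord0.
- by case=> [|l] [|i].
- by case=> [|[|l]] i.
- by move=> i hi; congr hpush; apply/funext => j; apply/funext => a; apply: nface_prism_diag.
- by move=> i hi; congr hpush; apply/funext => j; apply/funext => a; apply: nface_prism_subdiag.
Qed.

Lemma prism_homotopyS p (c : chain G p.+1) : hyperchain c ->
  bdry (prism_op c) + prism_op (bdry c) =
  push (fun a => eta m \o a) c - push (fun a => eta 0v \o a) c.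
Proof.
move=> hc; rewrite bdry_prism_op // prism_op_bdry // -stairs_ends //.
apply: (@prism_sum _ (fun l i => hpush m (fun j a => nface l (prism_map i j a)) c)
  (fun l i => hpush m (fun j a => prism_map i j (nface l a)) c)).
- move=> l i hi hl; congr hpush; apply/funext => j; apply/funext => a.
  exact: nface_prism_lt.
- move=> l i hi hl; congr hpush; apply/funext => j; apply/funext => a.
  exact: nface_prism_gt.
- by move=> i hi; congr hpush; apply/funext => j; apply/funext => a; apply: nface_prism_diag.
- by move=> i hi; congr hpush; apply/funext => j; apply/funext => a; apply: nface_prism_subdiag.
Qed.

End Prism.

End PrismOperator.

(** * Complexes of hyperfinite chains on a prescribed class of simplices *)

Section MicroComplexes.
Variables (N : nonstandard_universe) (G : internal_group (int_univ N)).
Local Notation V := (int_univ N).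
Let psV := int_pairing_structure N.
Local Notation "0v" := (zero psV).

Lemma mchain_subgroup p (Q : simplex V p -> Prop) : is_subgroup (mchain (G := G) Q).
Proof. by split=> [|x y]; [exact: mchain0|exact: mchain_sub]. Qed.

Lemma mchain_sub_set p (Q Q' : simplex V p -> Prop) : (forall a, Q a -> Q' a) ->
  mchain (G := G) Q `<=` mchain Q'.
Proof.
by move=> h c [n [g [s [hr hQ ->]]]]; exists n, g, s; split=> // i /hQ/h.
Qed.

(** [*f] and [eta 0v] are compared only on points of [*X], so the maps they induce are compared on
    chains of simplices there. *)
Lemma eq_push p q (phi psi : simplex V p -> simplex V q) (Q : simplex V p -> Prop)
    (c : chain G p) :
  dmap phi -> dmap psi -> (forall a, Q a -> phi a = psi a) -> mchain Q c ->
  push phi c = push psi c.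
Proof.
move=> d1 d2 h [n [g [s [hr hQ ->]]]]; rewrite !pushE //.
by apply: eq_fsum => // i /hQ/h.
Qed.

(** Additivity is available on hyperchains, where [boundary] and the induced maps have an additive
    description [T]. *)
Lemma hyper_additive_is_hom p q (Q Q0 : simplex V p -> Prop)
    (Q' Q0' : simplex V q -> Prop) (F T : chain G p -> chain G q) :
  (forall c, hyperchain c -> F c = T c) ->
  (forall x y, hyperchain x -> hyperchain y -> T (x - y) = T x - T y) ->
  (forall c, mchain Q c -> mchain Q' (T c)) ->
  (forall c, mchain Q0 c -> mchain Q0' (T c)) ->
  is_hom (mchain Q) (mchain Q0) (mchain Q') (mchain Q0') F.
Proof.
move=> FT TB hQ hQ0; split=> [c hc|c hc|x y hx hy].
- by rewrite FT; [exact: hQ|exact: mchain_hyper hc].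
- by rewrite FT; [exact: hQ0|exact: mchain_hyper hc].
- have hxy := mchain_add hx hy.
  move/mchain_hyper: hx => hx; move/mchain_hyper: hy => hy.
  rewrite !FT //; last exact: mchain_hyper hxy.
  by rewrite hyper_additiveD // subrr; apply: mchain0.
Qed.

Variables Q Q0 Q' Q0' : forall p, simplex V p -> Prop.
Hypothesis nfaceQ : forall p l (a : simplex V p.+1), Q a -> Q (nface l a).
Hypothesis nfaceQ0 : forall p l (a : simplex V p.+1), Q0 a -> Q0 (nface l a).
Hypothesis Q0Q : forall p (a : simplex V p), Q0 a -> Q a.

Lemma bdry_mchain p (P : forall p, simplex V p -> Prop) (c : chain G p.+1) :
  (forall p l (a : simplex V p.+1), P p.+1 a -> P p (nface l a)) ->
  mchain (P p.+1) c -> mchain (P p) (bdry c).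
Proof.
move=> hP hc; apply: mchain_sum => l; apply: mchain_mulrz.
by apply: push_mchain hc => [|a]; [exact: dmap_nface|exact: hP].
Qed.

(** Covers both cases of the theorem: with [P0] false everywhere the denominators are 0; with [P0]
    the microsimplices of a subset the complex is the relative one. *)
Definition simplex_complex (P P0 : forall p, simplex V p -> Prop) : complex :=
  @Complex (fun p => chain G p : zmodType) (fun p => mchain (P p))
    (fun p => mchain (P0 p)) (fun p => @boundary V G p).

Lemma simplex_complex_is_complex : is_complex (simplex_complex Q Q0).
Proof.
split=> [p|].
  by split; [exact: mchain_subgroup|exact: mchain_subgroup|apply: mchain_sub_set; exact: Q0Q].
split=> [p|p x hx].
  apply: (@hyper_additive_is_hom _ _ _ _ _ _ _ (@bdry N G p)).
  - exact: boundaryE.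
  - exact: bdry_sub.
  - by move=> c; apply: bdry_mchain.
  - by move=> c; apply: bdry_mchain.
have hb := bdry_mchain nfaceQ hx; have hh := mchain_hyper hx.
rewrite /= (boundaryE hh) boundaryE; last exact: mchain_hyper hb.
by rewrite bdry_bdry //; apply: mchain0.
Qed.

Definition map_simplex (f : V -> V) p (c : chain G p) : chain G p :=
  hyperlinear (fun a => elem (f \o a)) c.

Lemma dmap_map (f : V -> V) p : dT1 f -> dmap (fun a : simplex V p => f \o a).
Proof. by move=> df t ht k; apply: (dT1_sub df (ht k)). Qed.

Lemma map_simplex_is_chain_map (f : V -> V) : dT1 f ->
  (forall p (a : simplex V p), Q a -> Q' (f \o a)) ->
  (forall p (a : simplex V p), Q0 a -> Q0' (f \o a)) ->
  is_chain_map (C := simplex_complex Q Q0) (D := simplex_complex Q' Q0')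
    (map_simplex f).
Proof.
move=> df hQ hQ0; have dm p := @dmap_map f p df.
split=> [p|p x hx].
  apply: (@hyper_additive_is_hom _ _ _ _ _ _ _ (push (fun a => f \o a))).
  - by move=> c; apply: hyperlinear_elem.
  - by move=> x y; apply: push_sub.
  - by move=> c; apply: push_mchain => // a; apply: hQ.
  - by move=> c; apply: push_mchain => // a; apply: hQ0.
have hh := mchain_hyper hx; have hb := mchain_hyper (bdry_mchain nfaceQ hx).
rewrite /= /map_simplex !hyperlinear_elem ?(boundaryE hh) //.
rewrite boundaryE; last exact: hyper_push.
by rewrite push_map_bdry // subrr; apply: mchain0.
Qed.

Lemma prism_chain_homotopic (f g : V -> V) (m : V) (eta : V -> V -> V) :
  dT1 f -> dT1 g -> is_nat m -> dT2 eta ->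
  (forall p i j (a : simplex V p), j ∈ m -> Q a -> Q' (prism_map eta i j a)) ->
  (forall p i j (a : simplex V p), j ∈ m -> Q0 a -> Q0' (prism_map eta i j a)) ->
  (forall p (a : simplex V p), Q a -> eta 0v \o a = f \o a) ->
  (forall p (a : simplex V p), Q a -> eta m \o a = g \o a) ->
  chain_homotopic (C := simplex_complex Q Q0) (D := simplex_complex Q' Q0')
    (map_simplex f) (map_simplex g).
Proof.
move=> df dg hm deta hQ hQ0 hf hg.
have dmf p := @dmap_map f p df; have dmg p := @dmap_map g p dg.
have de j : dT1 (eta j) by definable.
have dme j p := @dmap_map (eta j) p (de j).
have ends p (c : chain G p) : mchain (@Q p) c ->
    map_simplex g c - map_simplex f c =
    push (fun a => eta m \o a) c - push (fun a => eta 0v \o a) c.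
  move=> hc; have hh := mchain_hyper hc.
  rewrite /map_simplex !hyperlinear_elem //.
  by congr (_ - _); apply/esym; apply: eq_push hc => // a; [apply: hg|apply: hf].
have prism_mchain p (P P' : forall p, simplex V p -> Prop) (c : chain G p) :
    (forall p i j (a : simplex V p), j ∈ m -> P p a -> P' p.+1 (prism_map eta i j a)) ->
    mchain (P p) c -> mchain (P' p.+1) (prism_op m eta c).
  move=> hP hc; apply: mchain_sum => i; apply: mchain_mulrz.
  by apply: hpush_mchain hc => [||j a]; [exact: dmap2_prism|by []|exact: hP].
have hprism p (c : chain G p) : mchain (@Q p) c -> hyperchain (prism_op m eta c).
  by move=> /(prism_mchain _ _ _ _ hQ)/mchain_hyper.
exists (fun p => @prism_op N G m eta p); split=> [p|x hx|p x hx].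
- apply: (@hyper_additive_is_hom _ _ _ _ _ _ _ (@prism_op N G m eta p)) => //.
  + by move=> x y; apply: prism_op_sub.
  + by move=> c; apply: prism_mchain.
  + by move=> c; apply: prism_mchain.
- have hh := mchain_hyper hx.
  rewrite /= boundaryE; last exact: hprism hx.
  rewrite (prism_homotopy0 hm deta hh) -(ends _ _ hx) subrr.
  exact: mchain0.
- have hh := mchain_hyper hx.
  rewrite /= !boundaryE //; last exact: hprism hx.
  rewrite (prism_homotopyS hm deta hh) -(ends _ _ hx) subrr.
  exact: mchain0.
Qed.

End MicroComplexes.

(** * Uniform structures *)

Lemma subset_entourageP (X : uniformType) (A : set X) (E : set (A * A)) :
  entourage E <-> exists2 D : set (X * X), entourage D &
    forall a b : A, D (set_val a, set_val b) -> E (a, b).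
Proof.
split=> [[D hD h]|[D hD h]]; exists D => //; first by move=> a b hab; apply: h.
by move=> [a b] /= hab; apply: h.
Qed.

Lemma product_entourage (X T : uniformType) (E : set ((X * T) * (X * T))) :
  entourage E -> exists (D : set (X * X)) (F : set (T * T)),
    [/\ entourage D, entourage F & forall x x' t t',
      D (x, x') -> F (t, t') -> E ((x, t), (x', t'))].
Proof.
move=> [[D F] [/= hD hF] h]; exists D, F; split=> // x x' t t' Dx Ft.
have /= [[[a b] [c d]] /= hE [<- <- <- <-]] := h ((x, x'), (t, t')) (conj Dx Ft).
exact: hE.
Qed.

Section UnitInterval.
Variable R : realType.
Local Notation I01 := (`[0, 1]%classic : set R).

Lemma unit_interval_entourage (F : set (I01 * I01)) : entourage F ->
  exists2 d : R, 0 < d & forall s t : I01, `|set_val s - set_val t| < d -> F (s, t).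
Proof.
move=> /subset_entourageP[D hD h].
have [d d0 hd] : exists2 d : R, 0 < d & [set xy : R * R | ball xy.1 d xy.2] `<=` D.
  by move: hD; rewrite -entourage_ballE => -[d d0 hd]; exists d.
by exists d => // s t st; apply: h; apply: hd.
Qed.

Lemma grid_subproof (n j : nat) : Num.min (j%:R / n%:R) 1 \in I01.
Proof.
rewrite inE /= in_itv /= ge_min lexx orbT andbT le_min ler01 andbT.
by apply: divr_ge0.
Qed.

(* This is j/n only for j <= n. *)
Definition grid (n j : nat) : I01 :=
  exist (fun x : R => x \in I01) _ (grid_subproof n j).

Lemma gridE n j : set_val (grid n j) = Num.min (j%:R / n%:R) 1.
Proof. by []. Qed.

Lemma grid0 n : set_val (grid n 0) = 0.
Proof. by rewrite gridE mul0r; apply/min_idPl. Qed.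

Lemma grid1 n : (0 < n)%N -> set_val (grid n n) = 1.
Proof.
by move=> hn; rewrite gridE divff ?minxx // pnatr_eq0 -lt0n.
Qed.

Lemma gridB n j : (0 < n)%N ->
  `|set_val (grid n j) - set_val (grid n j.+1)| <= n%:R^-1.
Proof.
move=> hn; have n0 : (0 : R) < n%:R^-1 by rewrite invr_gt0 ltr0n.
rewrite !gridE distrC -natr1 mulrDl mul1r.
set a := j%:R / n%:R; set b := n%:R^-1 in n0 *.
by rewrite !minEle; case: (leP (a + b) 1) => h1; case: (leP a 1) => h2;
  rewrite ger0_norm; lra.
Qed.

(** The cases for [j] and [j'] are the pairs of times that occur among the vertices of a prism. *)
Lemma grid_close (d : R) : 0 < d -> exists n0, forall n j j',
  (n0 < n)%N -> j' = j \/ j' = j.+1 \/ j = j'.+1 ->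
  `|set_val (grid n j) - set_val (grid n j')| < d.
Proof.
move=> d0; exists (Num.bound d^-1) => n j j' hn hj.
have n0 : (0 < n)%N by exact: leq_ltn_trans hn.
have nd : n%:R^-1 < d.
  rewrite invf_plt ?posrE ?ltr0n //.
  apply: lt_trans (archi_boundP _) _; first by rewrite invr_ge0 ltW.
  by rewrite ltr_nat.
case: hj => [->|[->|->]]; first by rewrite subrr normr0.
  exact: le_lt_trans (gridB _ n0) nd.
by rewrite distrC; exact: le_lt_trans (gridB _ n0) nd.
Qed.

End UnitInterval.

(** * Codings in the standard universe *)

Section Codings.
Variable N : nonstandard_universe.
Local Notation U := (std_univ N).
Let zU := std_zermelo N.
Let psU := zermelo_pairing_structure zU.

(** Separation needs a set to cut from: Kuratowski pairs lie in the double power set of the union of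
    [A] and [B]. *)
Lemma product_superset (A B : U) : exists P : U, forall x y,
  x ∈ A -> y ∈ B -> kpair psU x y ∈ P.
Proof.
have [AB hAB] := pairing zU A B; have [C hC] := union zU AB.
have [P1 h1] := power_set zU C; have [P2 h2] := power_set zU P1.
have memC x y z : x ∈ A -> y ∈ B -> z = x \/ z = y -> z ∈ C.
  by move=> xA yB [->|->]; apply/hC; [exists A|exists B] => //; apply/hAB; auto.
exists P2 => x y xA yB; apply/h2 => z /(kpairP psU x y) h; apply/h1 => w wz.
by apply: (memC x y) => //; case: h => h; move/h: wz; tauto.
Qed.

Lemma codes_rel_exists (S T : Type) (cS : coding U S) (cT : coding U T)
  (E : S -> T -> Prop) : exists e, codes_rel cS cT E e.
Proof.
have [P hP] := product_superset (cset cS) (cset cT).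
have [e he] := separation zU (fun z => exists x y, E x y /\ is_pair z (cS x) (cT y)) P.
exists e => z; rewrite he; split=> [[]//|[x [y [Exy hz]]]]; split; last by exists x, y.
move/(is_pairE psU): hz => ->; apply: hP; apply/csetP; first by exists x.
by exists y.
Qed.

Definition graph (S T : Type) (cS : coding U S) (cT : coding U T)
  (E : S -> T -> Prop) : U := projT1 (cid (codes_rel_exists cS cT E)).

Lemma graph_codes (S T : Type) (cS : coding U S) (cT : coding U T) E :
  codes_rel cS cT E (graph cS cT E).
Proof. by rewrite /graph; case: cid. Qed.

Lemma graphP (S T : Type) (cS : coding U S) (cT : coding U T) E u v :
  pair_in (graph cS cT E) u v <-> exists x y, [/\ E x y, u = cS x & v = cT y].
Proof.
rewrite (pair_inE psU) (graph_codes cS cT E).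
split=> [[x [y [Exy /(is_pairE psU)/kpair_inj[-> ->]]]]|[x [y [Exy -> ->]]]];
  by exists x, y; split=> //; apply/(is_pairE psU).
Qed.

Lemma graph_uniq (S T : Type) (cS : coding U S) (cT : coding U T) E e :
  codes_rel cS cT E e -> e = graph cS cT E.
Proof.
move=> he; apply: (extensionality zU) => z.
by rewrite (he z) (graph_codes cS cT E z).
Qed.

Section Product.
Variables (S T : Type) (cS : coding U S) (cT : coding U T).

Definition product_code (x : S * T) : U := kpair psU (cS x.1) (cT x.2).

Lemma product_code_inj : injective product_code.
Proof.
by move=> [x y] [x' y'] /kpair_inj[/(@code_inj _ _ cS) /= -> /(@code_inj _ _ cT) /= ->].
Qed.

Lemma product_csetP u : u ∈ graph cS cT (fun _ _ => True) <->
  exists t, product_code t = u.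
Proof.
rewrite (graph_codes cS cT (fun _ _ => True)).
split=> [[x [y [_ /(is_pairE psU) ->]]]|[[x y] <-]]; first by exists (x, y).
by exists x, y; split=> //; apply: kpairP.
Qed.

Definition product_coding : coding U (S * T) :=
  Coding product_code_inj product_csetP.

End Product.

Definition numeral (n : nat) : U := iter n (succ psU) (zero psU).

Lemma is_nat_numeral n : is_nat (numeral n).
Proof. by elim: n => [|n IH]; [exact: is_nat_zero|apply: is_nat_succ]. Qed.

Lemma inductive_exists : exists w : U, is_inductive w.
Proof.
have [w [[e he ew] hw]] := infinity zU.
exists w; split=> [e' /(is_emptyE psU) ->|x s /hw[s' hs' sw] hs].
  by move/(is_emptyE psU): he => <-.
by rewrite (succ_uniq psU hs hs').
Qed.

(** Separation in [U] applies to the metatheoretic predicate of being a numeral, so the numerals in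
    an inductive set form an inductive set, and [U] has only standard naturals. *)
Lemma is_natP u : is_nat u <-> exists n, numeral n = u.
Proof.
split=> [hu|[n <-]]; last exact: is_nat_numeral.
have [w hw] := inductive_exists.
have [W hW] := separation zU (fun z => exists n, numeral n = z) w.
suff /hu/hW[] : is_inductive W by [].
split=> [e /(is_emptyE psU) ->|x s /hW[xw [n E]] hs]; apply/hW.
  by split; [apply: (proj1 hw); apply: zeroP|exists 0%N].
split; first exact: (proj2 hw x).
by exists n.+1; rewrite /= -/(numeral n) E; apply/esym/(is_succE psU).
Qed.

Lemma mem_numeral u n : u ∈ numeral n <-> exists2 m, (m < n)%N & u = numeral m.
Proof.
elim: n u => [|n IH] u; first by split=> [/zeroP|[]].
rewrite /= succP IH; split=> [[[m hm ->]|->]|[m]].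
- by exists m => //; apply: ltnW.
- by exists n.
- by rewrite ltnS leq_eqVlt => /orP[/eqP ->|hm] ->; [right|left; exists m].
Qed.

Lemma numeral_mem m n : numeral m ∈ numeral n <-> (m < n)%N.
Proof.
split=> [|h]; last by apply/mem_numeral; exists m.
(* Foundation is not among the axioms, so irreflexivity is proved by induction on numerals. *)
have irr k : ~ numeral k ∈ numeral k.
  elim: k => [/zeroP//|k IH] h; apply: IH.
  have trans a b c : numeral a ∈ numeral b -> numeral b ∈ numeral c ->
      numeral a ∈ numeral c.
    move=> + /mem_numeral[b' hb' E]; rewrite E => /mem_numeral[a' ha' ->].
    by apply/mem_numeral; exists a' => //; apply: ltn_trans hb'.
  have kk : numeral k ∈ numeral k.+1 by apply/mem_numeral; exists k.
  case/succP: h => [h|h]; first exact: trans kk h.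
  have {}h : numeral k.+1 = numeral k := h.
  by move: kk; rewrite h.
case: (ltnP m n) => // hnm hmn; case: (irr n).
move: hnm; rewrite leq_eqVlt => /orP[/eqP E|hnm]; first by rewrite {1}E.
have /mem_numeral[k hk E] := hmn.
case: (irr m); rewrite {1}E; apply/mem_numeral; exists k => //.
exact: ltn_trans hk hnm.
Qed.

Lemma numeral_inj : injective numeral.
Proof.
move=> m n E; case: (ltngtP m n) => // h.
  by have := proj2 (numeral_mem m n) h; rewrite E => /(proj1 (numeral_mem n n)); rewrite ltnn.
by have := proj2 (numeral_mem n m) h; rewrite E => /(proj1 (numeral_mem n n)); rewrite ltnn.
Qed.

Lemma nat_cset_exists : exists w : U, forall u, u ∈ w <-> exists n, numeral n = u.
Proof.
have [w hw] := inductive_exists.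
have [W hW] := separation zU (fun z => exists n, numeral n = z) w.
exists W => u; rewrite hW; split=> [[]//|h]; split=> //.
by move/is_natP: h; apply.
Qed.

Definition nat_coding : coding U nat :=
  Coding numeral_inj (projT2 (cid nat_cset_exists)).

End Codings.

(** * Standard maps and relations in the internal universe *)

Section StandardObjects.
Variable N : nonstandard_universe.
Local Notation U := (std_univ N).
Local Notation V := (int_univ N).
Let zU := std_zermelo N.
Let psU := zermelo_pairing_structure zU.
Let psV := int_pairing_structure N.

(** The family [(u, *u)]: each transfer below states a sentence [P b] for both universes with such
    parameters and checks it at [b = false], where codes can be replaced by the objects that they
    code. *)
Definition standard (u : U) (b : bool) : two_univ N b :=
  if b return two_univ N b then star u else u.

Lemma dF_standard u : dF (@star_param N) (fun b _ => standard u b).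
Proof. exact: (@dF_const _ _ (@star_param N) (standard u)). Qed.

Lemma transfer_sentence (P : bool -> Prop) :
  dP (M := two_univ N) (@star_param N) (fun b _ => P b) -> P false -> P true.
Proof.
by move=> hP; apply: (proj1 (transfer (fun=> zero psU) hP)).
Qed.

Ltac standard_definable := repeat first
  [ lazymatch goal with |- dF _ _ => apply: dF_standard end | dp3 ].

Lemma star_relP (S T : Type) (cS : coding U S) (cT : coding U T) E (x y : V) :
  star_rel cS cT E x y <-> pair_in (star (graph cS cT E)) x y.
Proof.
split=> [[e /graph_uniq <- //]|h].
by exists (graph cS cT E) => //; apply: graph_codes.
Qed.

Section StarFun.
Variables (S T : Type) (cS : coding U S) (cT : coding U T) (f : S -> T).
Local Notation F := (graph cS cT (fun s t => f s = t)).

Lemma star_graph_total (x : V) : x ∈ star (cset cS) ->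
  exists y : V, pair_in (star F) x y.
Proof.
move: x; pose P (b : bool) := forall x : two_univ N b, x ∈ standard (cset cS) b ->
  exists y, pair_in (standard F b) x y.
apply: (@transfer_sentence P); first by rewrite /P; standard_definable.
move=> x /csetP[s <-]; exists (cT (f s)).
by apply/graphP; exists s, (f s).
Qed.

Lemma star_graph_range (x y : V) : pair_in (star F) x y ->
  x ∈ star (cset cS) /\ y ∈ star (cset cT).
Proof.
move: x y; pose P (b : bool) := forall x y : two_univ N b,
  pair_in (standard F b) x y -> x ∈ standard (cset cS) b /\ y ∈ standard (cset cT) b.
apply: (@transfer_sentence P); first by rewrite /P; standard_definable.
move=> x y /graphP[s [t [_ -> ->]]].
by split; apply/csetP; [exists s|exists t].
Qed.

Lemma star_graph_functional (x y y' : V) : pair_in (star F) x y ->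
  pair_in (star F) x y' -> y = y'.
Proof.
move: x y y'; pose P (b : bool) := forall x y y' : two_univ N b,
  pair_in (standard F b) x y -> pair_in (standard F b) x y' -> y = y'.
apply: (@transfer_sentence P); first by rewrite /P; standard_definable.
move=> x y y' /graphP[s [t [<- -> ->]]] /graphP[s' [t' [<- /(@code_inj _ _ cS) -> ->]]].
by [].
Qed.

Lemma star_funE (x y : V) : pair_in (star F) x y -> star_fun cS cT f x = y.
Proof.
move=> h; rewrite /star_fun; case: xgetP => [z _ /star_relP hz|].
  exact: star_graph_functional hz h.
by move/(_ y) => /= nh; case: nh; apply/star_relP.
Qed.

Lemma star_fun_graph (x : V) : x ∈ star (cset cS) ->
  pair_in (star F) x (star_fun cS cT f x).
Proof. by move=> /star_graph_total[y hy]; rewrite (star_funE hy). Qed.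

Lemma star_fun_mem (x : V) : x ∈ star (cset cS) -> star_fun cS cT f x ∈ star (cset cT).
Proof. by move=> /star_fun_graph/star_graph_range[]. Qed.

Lemma dT1_star_fun : dT1 (star_fun cS cT f).
Proof.
(* Outside [*S] no value exists and [xget] returns its default, which is the argument itself; this
   is the second disjunct. *)
have H : dV V (fun _ e => pair_in (star F) (e 1%N) (e 0%N) \/
    (~ (exists y, pair_in (star F) (e 1%N) y) /\ e 0%N = e 1%N)).
  by repeat dp4.
refine (dP_ext _ H) => _ e.
have [[y hy]|hn] := pselect (exists y, pair_in (star F) (e 1%N) y).
  rewrite (star_funE hy); split=> [[h|[[]]]|->]; last by left.
    exact: star_graph_functional h hy.
  by exists y.
have -> : star_fun cS cT f (e 1%N) = e 1%N.
  rewrite /star_fun; case: xgetP => // z _ /star_relP hz.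
  by case: hn; exists z.
by split=> [[h|[]//]|->]; [case: hn; exists (e 0%N)|right].
Qed.

End StarFun.

(** Infinite closeness is external, so transfer is applied to one entourage at a time, together with
    its inverse image under [f]. *)
Lemma star_fun_close (X Y : uniformType) (cX : coding U X) (cY : coding U Y)
    (f : X -> Y) (x x' : V) : unif_continuous f ->
  x ∈ star (cset cX) -> x' ∈ star (cset cX) -> infinitely_close cX x x' ->
  infinitely_close cY (star_fun cX cY f x) (star_fun cX cY f x').
Proof.
move=> hf hx hx' hxx E hE.
have hE' : entourage [set xy | E (f xy.1, f xy.2)] := hf E hE.
have /star_relP := hxx _ hE'; apply: (fun p q => proj2 (star_relP cY cY _ _ _) (p q)).
have := star_fun_graph cY f hx'; have := star_fun_graph cY f hx.
move: (star_fun cX cY f x) (star_fun cX cY f x') => y y'.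
set F := graph cX cY _; set D := graph cX cX _; set D' := graph cY cY _.
move: x x' y y' {hx hx' hxx}.
pose P (b : bool) := forall x x' y y' : two_univ N b,
  pair_in (standard F b) x y -> pair_in (standard F b) x' y' ->
  pair_in (standard D b) x x' -> pair_in (standard D' b) y y'.
suff : P true by [].
apply: (@transfer_sentence P); first by rewrite /P; standard_definable.
move=> x x' y y' /graphP[s [t [<- -> ->]]] /graphP[s' [t' [<- -> ->]]].
move=> /graphP[r [r' [hr /(@code_inj _ _ cX) -> /(@code_inj _ _ cX) ->]]].
by apply/graphP; exists (f r), (f r').
Qed.

Lemma microsimplex_map (X Y : uniformType) (cX : coding U X) (cY : coding U Y)
    (f : X -> Y) p (a : simplex V p) : unif_continuous f ->
  microsimplex cX a -> microsimplex cY (star_fun cX cY f \o a).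
Proof.
move=> hf [h1 h2]; split=> [k|k l]; first exact: star_fun_mem.
exact: star_fun_close.
Qed.

Section Subset.
Variables (X : uniformType) (cX : coding U X) (A : set X).
Local Notation cA := (sub_coding zU cX A).

Lemma star_subset (x : V) : x ∈ star (cset cA) -> x ∈ star (cset cX).
Proof.
move: x; pose P (b : bool) := forall x : two_univ N b,
  x ∈ standard (cset cA) b -> x ∈ standard (cset cX) b.
apply: (@transfer_sentence P); first by rewrite /P; standard_definable.
by move=> x /csetP[s <-]; apply/csetP; exists (set_val s).
Qed.

Lemma sub_close (x y : V) : infinitely_close cA x y -> infinitely_close cX x y.
Proof.
move=> h E hE; apply/star_relP.
have hE' : entourage [set ab : A * A | E (set_val ab.1, set_val ab.2)].
  by apply/subset_entourageP; exists E.
have /star_relP := h _ hE'; set D := graph cA cA _; set D' := graph cX cX _.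
move: x y {h}; pose P (b : bool) := forall x y : two_univ N b,
  pair_in (standard D b) x y -> pair_in (standard D' b) x y.
apply: (@transfer_sentence P); first by rewrite /P; standard_definable.
move=> x y /graphP[s [t [h -> ->]]]; apply/graphP.
by exists (set_val s), (set_val t).
Qed.

Lemma close_sub (x y : V) : x ∈ star (cset cA) -> y ∈ star (cset cA) ->
  infinitely_close cX x y -> infinitely_close cA x y.
Proof.
move=> hx hy h E /subset_entourageP[D hD hDE]; apply/star_relP.
have /star_relP := h D hD; move: x y hx hy {h}.
set F := graph cA cA _; set F' := graph cX cX _.
pose P (b : bool) := forall x y : two_univ N b, x ∈ standard (cset cA) b ->
  y ∈ standard (cset cA) b -> pair_in (standard F' b) x y -> pair_in (standard F b) x y.
apply: (@transfer_sentence P); first by rewrite /P; standard_definable.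
move=> x y /csetP[s <-] /csetP[t <-] /graphP[s' [t' [h E1 E2]]].
apply/graphP; exists s, t; split=> //; apply: hDE.
by rewrite (@code_inj _ _ cX (set_val s) s' E1) (@code_inj _ _ cX (set_val t) t' E2).
Qed.

Lemma sub_microsimplexP p (a : simplex V p) : microsimplex cA a <->
  (forall k, a k ∈ star (cset cA)) /\ microsimplex cX a.
Proof.
split=> [[h1 h2]|[h1 [_ h2]]].
  by do 2!split=> //; [move=> k; exact: star_subset|move=> k l; exact: sub_close].
by split=> // k l; exact: close_sub.
Qed.

End Subset.

Lemma star_fun_subset (X Y : uniformType) (cX : coding U X) (cY : coding U Y)
    (A : set X) (B : set Y) (f : X -> Y) (x : V) : f @` A `<=` B ->
  x ∈ star (cset (sub_coding zU cX A)) ->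
  star_fun cX cY f x ∈ star (cset (sub_coding zU cY B)).
Proof.
move=> fAB hx; have := star_fun_graph cY f (star_subset hx).
move: (star_fun cX cY f x) => y; move: x y hx.
set F := graph cX cY _; set CA := cset _; set CB := cset _.
pose P (b : bool) := forall x y : two_univ N b, x ∈ standard CA b ->
  pair_in (standard F b) x y -> y ∈ standard CB b.
apply: (@transfer_sentence P); first by rewrite /P; standard_definable.
move=> x y /csetP[s <-] /graphP[s' [t [<- /(@code_inj _ _ cX) <- ->]]].
have Bs : B (f (set_val s)) by apply: fAB; exists (set_val s) => //; exact: set_valP.
by apply/csetP; exists (exist (fun y => y \in B) _ (mem_set Bs)).
Qed.

Lemma star_natP (n : V) : is_nat n <-> n ∈ star (cset (nat_coding N)).
Proof.
move: n; pose P (b : bool) := forall n : two_univ N b,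
  is_nat n <-> n ∈ standard (cset (nat_coding N)) b.
apply: (@transfer_sentence P); first by rewrite /P; standard_definable.
by move=> n; rewrite is_natP; apply: iff_sym; apply: csetP.
Qed.

Lemma star_mem (u v : U) : u ∈ v -> (star u : V) ∈ star v.
Proof.
exact: (proj1 (star_elementary (FMem 0 1) (scons u (fun=> v)))).
Qed.

Lemma infinite_nat_exists : exists m : V, is_nat m /\ forall k, star (numeral N k) ∈ m.
Proof.
pose W := star (cset (nat_coding N)).
(* The condition with index [k] says that the unknown contains the numeral [k] and lies in the set
   of hypernaturals. Finitely many conditions are met by a large numeral, and the numerals embed the
   index type into [U], as saturation demands. *)
have [|k j|m hm] := @int_saturated N nat (numeral N)
   (fun=> FAnd (FMem 1 0) (FMem 0 2))
   (fun k => scons (star (numeral N k)) (fun=> W)).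
- exact: numeral_inj.
- set M := (\max_(l < k) j l).+1; exists (star (numeral N M)) => l.
  have h1 : (star (numeral N (j l)) : V) ∈ star (numeral N M).
    by apply/star_mem/numeral_mem; rewrite ltnS; apply: leq_bigmax.
  have h2 : (star (numeral N M) : V) ∈ W by apply/star_mem/csetP; exists M.
  by split.
exists m; split; first by apply/star_natP; have [] := hm 0%N.
by move=> k; have [] := hm k.
Qed.

End StandardObjects.

(** * Sampling a homotopy on a hyperfinite grid *)

Section Grid.
Variables (R : realType) (N : nonstandard_universe) (X Y : uniformType).
Local Notation U := (std_univ N).
Local Notation V := (int_univ N).
Local Notation I01 := (`[0, 1]%classic : set R).
Variables (cX : coding U X) (cY : coding U Y) (h : X * I01 -> Y) (f g : X -> Y).
Hypothesis hfg : is_unif_homotopy f g h.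
Variable m : V.
Hypotheses (hm : is_nat m) (m_infinite : forall k, (star (numeral N k) : V) ∈ m).
Let zU := std_zermelo N.
Let psU := zermelo_pairing_structure zU.
Let psV := int_pairing_structure N.
Local Notation "0v" := (zero psV).
Local Notation sc := (succ psV).
Local Notation cnat := (nat_coding N).

Definition sample_coding : coding U (nat * nat * X) :=
  product_coding (product_coding cnat cnat) cX.

(* Sampling h at the rationals j/n keeps the reals out of the universe. *)
Definition sample (q : nat * nat * X) : Y := h (q.2, grid R q.1.1 q.1.2).

Local Notation S := (graph sample_coding cY (fun q y => sample q = y)).

(* eta j x = *h(x, j/m) *)
Definition eta (j x : V) : V :=
  star_fun sample_coding cY sample (kpair psV (kpair psV m j) x).

Ltac standard_definable := repeat first
  [ lazymatch goal with |- dF _ _ => apply: dF_standard end | dp3 ].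

Lemma dT2_eta : dT2 eta.
Proof.
apply: (dT1_sub (t := fun _ e => kpair psV (kpair psV m (e 0%N)) (e 1%N))).
  exact: dT1_star_fun.
by repeat dp4.
Qed.

(** A relational form of the triple: [kpair] depends on the universe that it is taken in, whereas
    this formula reads the same in both. *)
Definition is_triple (M : mstruct) (w n j x : M) :=
  exists v, is_pair v n j /\ is_pair w v x.


Lemma std_triple (w : U) a b t :
  is_triple w (numeral N a) (numeral N b) (cX t) -> w = sample_coding ((a, b), t).
Proof. by move=> [v [/(is_pairE psU) -> /(is_pairE psU) ->]]. Qed.

Lemma std_graph (w y : U) a b t :
  is_triple w (numeral N a) (numeral N b) (cX t) -> pair_in S w y ->
  y = cY (h (t, grid R a b)).
Proof.
move=> /std_triple -> /graphP[q [y' [<- /(@code_inj _ _ sample_coding) <- ->]]].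
by [].
Qed.

Lemma eta_graph (j x : V) : is_nat j -> x ∈ star (cset cX) ->
  exists w, is_triple w m j x /\ pair_in (star S) w (eta j x).
Proof.
move=> hj hx; exists (kpair psV (kpair psV m j) x); split.
  by exists (kpair psV m j); split; apply: kpairP.
apply: star_fun_graph.
have : is_triple (kpair psV (kpair psV m j) x) m j x.
  by exists (kpair psV m j); split; apply: kpairP.
move: (kpair _ _ _) => w; move: hm hj => /star_natP + /star_natP.
move: m j x hx w.
pose P (b : bool) := forall n j x : two_univ N b, x ∈ standard (cset cX) b ->
  forall w, n ∈ standard (cset cnat) b -> j ∈ standard (cset cnat) b ->
  is_triple w n j x -> w ∈ standard (cset sample_coding) b.
apply: (@transfer_sentence N P); first by rewrite /P /is_triple; standard_definable.
move=> n j x /csetP[t <-] w /csetP[a <-] /csetP[b <-] /std_triple ->.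
by apply/csetP; exists ((a, b), t).
Qed.

Lemma eta_mem (j x : V) : is_nat j -> x ∈ star (cset cX) -> eta j x ∈ star (cset cY).
Proof. by move=> hj hx; have [w [_ /star_graph_range[]]] := eta_graph hj hx. Qed.

Lemma eta0 (x : V) : x ∈ star (cset cX) -> eta 0v x = star_fun cX cY f x.
Proof.
move=> hx; have hz := is_nat_zero psV; apply/esym/star_funE.
have [w [+ +]] := eta_graph hz hx.
(* [0v] is generalized to an arbitrary empty set, so that the sentence makes sense in both
   universes. *)
have := @zeroP _ psV; have /star_natP := hm; move: (zero psV) (eta 0v x) => z y.
move: m x hx w z y.
set F := graph cX cY _; pose P (b : bool) := forall n x : two_univ N b,
  x ∈ standard (cset cX) b -> forall w z y, n ∈ standard (cset cnat) b ->
  is_empty z -> is_triple w n z x -> pair_in (standard S b) w y ->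
  pair_in (standard F b) x y.
apply: (@transfer_sentence N P); first by rewrite /P /is_triple; standard_definable.
move=> n x /csetP[t <-] w z y /csetP[a <-] /(is_emptyE psU) -> ht.
move=> /(std_graph (b := 0%N) ht) ->; apply/graphP.
by exists t, (h (t, grid R a 0)); split=> //; have [_ /(_ t (grid R a 0))[-> //]] := hfg; apply: grid0.
Qed.

Lemma eta_top (x : V) : x ∈ star (cset cX) -> eta m x = star_fun cX cY g x.
Proof.
move=> hx; apply/esym/star_funE; have [w [+ +]] := eta_graph hm hx.
(* The last grid point of [a] steps is 1 only for [0 < a], so the transferred sentence carries the
   assumption that [n] has an element. *)
have : exists z, z ∈ m by exists (star (numeral N 0)).
have /star_natP := hm; move: (eta m x) => y; move: m x hx w y.
set F := graph cX cY _; pose P (b : bool) := forall n x : two_univ N b,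
  x ∈ standard (cset cX) b -> forall w y, n ∈ standard (cset cnat) b ->
  (exists z, z ∈ n) -> is_triple w n n x -> pair_in (standard S b) w y ->
  pair_in (standard F b) x y.
apply: (@transfer_sentence N P); first by rewrite /P /is_triple; standard_definable.
move=> n x /csetP[t <-] w y /csetP[a <-] [z /mem_numeral[k hk _]] ht.
have a0 : (0 < a)%N by exact: leq_ltn_trans hk.
move=> /(std_graph ht) ->; apply/graphP.
by exists t, (h (t, grid R a a)); split=> //; have [_ /(_ t (grid R a a))[_ -> //]] := hfg; apply: grid1.
Qed.

(** For a fixed entourage [E], uniform continuity of [h] provides an entourage of [X] and a length
    [d], and the grids with more than some standard [n0] steps have steps shorter than [d]. The
    resulting statement about all [n] above [n0] transfers, and the infinite [m] lies above the [n0]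
    of every [E]. *)
Lemma eta_close (j j' x x' : V) : is_nat j -> is_nat j' ->
  j' = j \/ j' = sc j \/ j = sc j' ->
  x ∈ star (cset cX) -> x' ∈ star (cset cX) -> infinitely_close cX x x' ->
  infinitely_close cY (eta j x) (eta j' x').
Proof.
move=> hj hj' jj hx hx' hxx E hE; apply: (proj2 (star_relP cY cY _ _ _)).
have [hu _] := hfg.
have hE' : entourage [set xy | E (h xy.1, h xy.2)] := hu E hE.
have [D [F [hD hF hDF]]] := product_entourage hE'.
have [d d0 hd] := unit_interval_entourage hF.
have [n0 hn0] := grid_close d0.
have /star_relP := hxx D hD; set GD := graph cX cX _; set GE := graph cY cY _.
have [w [+ +]] := eta_graph hj hx; have [w' [+ +]] := eta_graph hj' hx'.
move: (eta j x) (eta j' x') => y y'.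
have adj : j' = j \/ is_succ j j' \/ is_succ j' j.
  by case: jj => [|[]] E1; [left|right; left|right; right] => //; apply/(is_succE psV).
have hn := m_infinite n0; move: hm hj hj' => /star_natP + /star_natP + /star_natP.
move: m j j' x x' w w' y y' adj hn {jj hx hx' hxx}.
pose P (b : bool) := forall n j j' x x' w w' y y' : two_univ N b,
  j' = j \/ is_succ j j' \/ is_succ j' j -> standard (numeral N n0) b ∈ n ->
  n ∈ standard (cset cnat) b -> j ∈ standard (cset cnat) b ->
  j' ∈ standard (cset cnat) b -> is_triple w' n j' x' ->
  pair_in (standard S b) w' y' -> is_triple w n j x -> pair_in (standard S b) w y ->
  pair_in (standard GD b) x x' -> pair_in (standard GE b) y y'.
suff : P true by [].
apply: (@transfer_sentence N P); first by rewrite /P /is_triple; standard_definable.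
move=> n j j' x x' w w' y y' adj hn /csetP[a E1] /csetP[b E2] /csetP[b' E3].
subst n j j'; move=> ht' hy' ht hy /graphP[s [s' [Ds E1 E2]]]; subst x x'.
rewrite (std_graph ht hy) (std_graph ht' hy'); apply/graphP.
exists (h (s, grid R a b)), (h (s', grid R a b')); split=> //.
apply: (hDF s s' (grid R a b) (grid R a b')) => //; apply/hd/hn0.
  exact/(numeral_mem N).
case: adj => [/numeral_inj|[/(is_succE psU)|/(is_succE psU)]] Ej.
- by left.
- by right; left; exact: (@numeral_inj N b' b.+1 Ej).
- by right; right; exact: (@numeral_inj N b b'.+1 Ej).
Qed.

Lemma eta_subset (A : set X) (B : set Y) (j x : V) :
  (forall (x : X) (t : I01), A x -> B (h (x, t))) -> is_nat j ->
  x ∈ star (cset (sub_coding zU cX A)) ->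
  eta j x ∈ star (cset (sub_coding zU cY B)).
Proof.
move=> hAB hj hx; have [w [+ +]] := eta_graph hj (star_subset hx).
move: (eta j x) => y; move: hm hj => /star_natP + /star_natP.
move: m j x hx w y; set CA := cset (sub_coding _ _ A); set CB := cset (sub_coding _ _ B).
pose P (b : bool) := forall n j x : two_univ N b, x ∈ standard CA b -> forall w y,
  n ∈ standard (cset cnat) b -> j ∈ standard (cset cnat) b ->
  is_triple w n j x -> pair_in (standard S b) w y -> y ∈ standard CB b.
apply: (@transfer_sentence N P); first by rewrite /P /is_triple; standard_definable.
move=> n j x /csetP[t <-] w y /csetP[a <-] /csetP[b <-] ht /(std_graph ht) ->.
have Bs : B (h (set_val t, grid R a b)) by apply: hAB; exact: set_valP.
by apply/csetP; exists (exist (fun y => y \in B) _ (mem_set Bs)).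
Qed.

Lemma prism_nodes p i (j : V) (a : simplex V p) k : j ∈ m ->
  exists j' l, [/\ j' = j \/ j' = sc j, is_nat j' & prism_map eta i j a k = eta j' (a l)].
Proof.
move=> hj; have nj := nat_mem hm hj; rewrite /prism_map /prism; case: (k <= i)%N.
  by exists j, (inord k); split=> //; left.
by exists (sc j), (inord k.-1); split; [right|apply: is_nat_succ|].
Qed.

Lemma prism_microsimplex p i (j : V) (a : simplex V p) : j ∈ m ->
  microsimplex cX a -> microsimplex cY (prism_map eta i j a).
Proof.
move=> hj [h1 h2]; split=> [k|k l].
  by have [j' [l [_ nj' ->]]] := prism_nodes i a k hj; apply: eta_mem.
have [j1 [l1 [e1 n1 ->]]] := prism_nodes i a k hj.
have [j2 [l2 [e2 n2 ->]]] := prism_nodes i a l hj.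
apply: eta_close => //; case: e1 => E1; case: e2 => E2; rewrite E1 E2; auto.
Qed.

Lemma prism_sub_microsimplex (A : set X) (B : set Y) p i (j : V) (a : simplex V p) :
  (forall (x : X) (t : I01), A x -> B (h (x, t))) -> j ∈ m ->
  microsimplex (sub_coding zU cX A) a ->
  microsimplex (sub_coding zU cY B) (prism_map eta i j a).
Proof.
move=> hAB hj /sub_microsimplexP[ha ma]; apply/sub_microsimplexP.
split; last exact: prism_microsimplex.
by move=> k; have [j' [l [_ nj' ->]]] := prism_nodes i a k hj; apply: (eta_subset hAB).
Qed.

End Grid.

(** * Homotopy invariance, absolute and relative *)

Section MainTheorem.
Variables (R : realType) (N : nonstandard_universe) (X Y : uniformType).
Variables (cX : coding (std_univ N) X) (cY : coding (std_univ N) Y).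
Variables (G : internal_group (int_univ N)) (f g : X -> Y).
Hypotheses (hf : unif_continuous f) (hg : unif_continuous g).
Variable h : X * (`[0, 1]%classic : set R) -> Y.
Hypothesis hfg : is_unif_homotopy f g h.
Local Notation V := (int_univ N).

Lemma nface_microsimplex (Z : uniformType) (cZ : coding (std_univ N) Z) p l
    (a : simplex V p.+1) : microsimplex cZ a -> microsimplex cZ (nface l a).
Proof. by move=> [h1 h2]; split=> [k|k k']; [exact: h1|exact: h2]. Qed.

(** Common form of the two cases, with [Q0] and [Q0'] the simplices that are divided out. The groups
    are given through equations because microchains agree with [mchain] only by extensionality. *)
Lemma homotopy_invariance (numC denC numD denD : forall p, set (chain G p))
    (Q0 Q0' : forall p, simplex V p -> Prop) :
  (forall p l (a : simplex V p.+1), Q0 p.+1 a -> Q0 p (nface l a)) ->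
  (forall p l (a : simplex V p.+1), Q0' p.+1 a -> Q0' p (nface l a)) ->
  (forall p (a : simplex V p), Q0 p a -> microsimplex cX a) ->
  (forall p (a : simplex V p), Q0' p a -> microsimplex cY a) ->
  (forall p (a : simplex V p), Q0 p a -> Q0' p (star_fun cX cY f \o a)) ->
  (forall p (a : simplex V p), Q0 p a -> Q0' p (star_fun cX cY g \o a)) ->
  (forall m : V, is_nat m -> (forall k, (star (numeral N k) : V) ∈ m) ->
     forall p i j (a : simplex V p), j ∈ m -> Q0 p a ->
     Q0' p.+1 (prism_map (eta cX cY h m) i j a)) ->
  (forall p, numC p = mchain (microsimplex cX (p := p))) ->
  (forall p, denC p = mchain (Q0 p)) ->
  (forall p, numD p = mchain (microsimplex cY (p := p))) ->
  (forall p, denD p = mchain (Q0' p)) ->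
  let C := @Complex (fun p => chain G p : zmodType) numC denC (@boundary V G) in
  let D := @Complex (fun p => chain G p : zmodType) numD denD (@boundary V G) in
  let Mf : forall p, amb C p -> amb D p := micromap G cX cY f in
  let Mg : forall p, amb C p -> amb D p := micromap G cX cY g in
  [/\ is_complex C /\ is_complex D, is_chain_map Mf /\ is_chain_map Mg,
      chain_homotopic Mf Mg
    & forall p xi, homology C p xi -> homology_map Mf xi = homology_map Mg xi].
Proof.
move=> nQ0 nQ0' Q0Q Q0Q' Q0f Q0g Q0p.
move=> e1 e2 e3 e4.
(* Rewriting the whole families, and not degree by degree, turns [C] and [D] into instances of
   [simplex_complex]. *)
have {e1} -> : numC = (fun p => mchain (microsimplex cX (p := p))).
  exact: functional_extensionality_dep e1.
have {e2} -> : denC = (fun p => mchain (Q0 p)).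
  exact: functional_extensionality_dep e2.
have {e3} -> : numD = (fun p => mchain (microsimplex cY (p := p))).
  exact: functional_extensionality_dep e3.
have {e4} -> : denD = (fun p => mchain (Q0' p)).
  exact: functional_extensionality_dep e4.
move=> C D Mf Mg.
have [m [hm m_inf]] := infinite_nat_exists N.
have cC : is_complex C.
  apply: simplex_complex_is_complex => //; exact: nface_microsimplex.
have cD : is_complex D.
  apply: simplex_complex_is_complex => //; exact: nface_microsimplex.
have mf : is_chain_map Mf.
  apply: map_simplex_is_chain_map => //; first exact: nface_microsimplex.
    exact: dT1_star_fun.
  by move=> p a; apply: microsimplex_map.
have mg : is_chain_map Mg.
  apply: map_simplex_is_chain_map => //; first exact: nface_microsimplex.
    exact: dT1_star_fun.
  by move=> p a; apply: microsimplex_map.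
have hom : chain_homotopic Mf Mg.
  apply: (@prism_chain_homotopic N G _ _ _ _ (star_fun cX cY f)
    (star_fun cX cY g) m (eta cX cY h m)) => //.
  - exact: dT1_star_fun.
  - exact: dT1_star_fun.
  - exact: dT2_eta.
  - by move=> p i j a; apply: prism_microsimplex hfg _ _ _ _ _ _ _.
  - exact: (Q0p m).
  - by move=> p a [ha _]; apply/funext => k; apply: (eta0 cY hfg).
  - by move=> p a [ha _]; apply/funext => k; apply: (eta_top cY hfg).
by split=> //; apply: homotopic_homology.
Qed.

Lemma zero_mchain p : [set 0 : chain G p] = mchain (fun=> False).
Proof.
apply/seteqP; split=> c /=; last exact: mchain_none.
by move=> ->; apply: mchain0.
Qed.

End MainTheorem.

Theorem proposition1 (R : realType) (N : nonstandard_universe)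
    (X Y : uniformType) (cX : coding (std_univ N) X) (cY : coding (std_univ N) Y)
    (G : internal_group (int_univ N)) :
  (forall f g : X -> Y,
     unif_continuous f -> unif_continuous g -> unif_homotopic R f g ->
     let MX := microcomplex G cX in
     let MY := microcomplex G cY in
     let Mf : forall p, amb MX p -> amb MY p := micromap G cX cY f in
     let Mg : forall p, amb MX p -> amb MY p := micromap G cX cY g in
     [/\ is_complex MX /\ is_complex MY,
         is_chain_map Mf /\ is_chain_map Mg,
         chain_homotopic Mf Mg
       & forall p xi, homology MX p xi ->
           homology_map Mf xi = homology_map Mg xi])
  /\
  (forall (A : set X) (B : set Y) (f g : X -> Y),
     unif_continuous f -> unif_continuous g ->
     f @` A `<=` B -> g @` A `<=` B -> unif_homotopic_pairs R A B f g ->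
     let MXA := rel_microcomplex G cX A in
     let MYB := rel_microcomplex G cY B in
     let Mf : forall p, amb MXA p -> amb MYB p := micromap G cX cY f in
     let Mg : forall p, amb MXA p -> amb MYB p := micromap G cX cY g in
     [/\ is_complex MXA /\ is_complex MYB,
         is_chain_map Mf /\ is_chain_map Mg,
         chain_homotopic Mf Mg
       & forall p xi, homology MXA p xi ->
           homology_map Mf xi = homology_map Mg xi]).
Proof.
split=> [f g hf hg [h hfg]|A B f g hf hg fAB gAB [h hfg hAB]].
  (* The absolute case divides by chains without simplices, that is, by 0. *)
  apply: (homotopy_invariance hf hg hfg (Q0 := fun _ _ => False)
    (Q0' := fun _ _ => False)) => // p.
  - exact: microchain_mchainE.
  - exact: zero_mchain.
  - exact: microchain_mchainE.
  - exact: zero_mchain.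
pose cA := sub_coding (std_zermelo N) cX A.
pose cB := sub_coding (std_zermelo N) cY B.
apply: (homotopy_invariance hf hg hfg (Q0 := fun p => microsimplex cA (p := p))
  (Q0' := fun p => microsimplex cB (p := p))).
- by move=> p l a; apply: nface_microsimplex.
- by move=> p l a; apply: nface_microsimplex.
- by move=> p a /sub_microsimplexP[].
- by move=> p a /sub_microsimplexP[].
- move=> p a /sub_microsimplexP[h1 h2]; apply/sub_microsimplexP.
  by split; [move=> k; apply: (star_fun_subset cY fAB)|apply: microsimplex_map].
- move=> p a /sub_microsimplexP[h1 h2]; apply/sub_microsimplexP.
  by split; [move=> k; apply: (star_fun_subset cY gAB)|apply: microsimplex_map].
- by move=> m hm mi p i j a; exact: (prism_sub_microsimplex cY hfg hm mi i hAB).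
- by move=> p; apply: microchain_mchainE.
- by move=> p; apply: microchain_mchainE.
- by move=> p; apply: microchain_mchainE.
- by move=> p; apply: microchain_mchainE.
Qed.
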